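(* Let $R=\bigoplus_{\mathbf n\in\mathbb N_0^r}R_{\mathbf n}$ be positively graded and standard, let $M$ be a finitely generated $\mathbb Z^r$-graded $R$-module, and let $\mathfrak b$ be an $\mathbb N_0^r$-graded ideal of $R$. Let $\mathbf m\in\mathbb N_0^r\setminus\{\mathbf 0\}$ and let $f$ be a positive integer. The following statements are equivalent: (i) $R_{\mathbf m}\subseteq\sqrt{(0:_RH^i_{\mathfrak b}(M))}$ for all integers $i<f$; (ii) for each integer $i<f$, there is a $\mathcal P(\mathbf m)$-domain $\mathbb X_i$ in $\mathbb Z^r$ such that $\mathcal S(H^i_{\mathfrak b}(M))\subseteq\mathbb X_i$, that is, $f\le g^{\mathcal P(\mathbf m)}_{\mathfrak b}(M)$; (iii) there is a $\mathcal P(\mathbf m)$-domain $\mathbb X$ in $\mathbb Z^r$ such that $\mathcal S(H^i_{\mathfrak b}(M))\subseteq\mathbb X$ for all integers $i<f$.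
   Context: $r$ is a positive integer; $\mathbb N_0$ is the set of non-negative integers. $R$ is a commutative Noetherian ring graded by $\mathbb Z^r$. On $\mathbb Z^r$, $\mathbf n\le\mathbf m$ means $n_i\le m_i$ for all $i$; $\mathbf e_i$ is the $i$th unit vector. $R$ is positively graded if $R_{\mathbf n}=0$ for all $\mathbf n\not\ge\mathbf 0$; it is then standard if $R=R_{\mathbf 0}[R_{\mathbf e_1},\dots,R_{\mathbf e_r}]$. For $\mathbf n\in\mathbb N_0^r$, $\mathcal P(\mathbf n)=\{i\in\{1,\dots,r\}:n_i\ne0\}$. For a $\mathbb Z^r$-graded $R$-module $N$, $\mathcal S(N)=\{\mathbf n\in\mathbb Z^r:N_{\mathbf n}\ne0\}$. For $\mathbf s,\mathbf t\in\mathbb Z^r$ with $\mathbf s\le\mathbf t$, $\mathbb X(\mathbf s,\mathbf t)=\{\mathbf n\in\mathbb Z^r:\text{there exists }i\in\{1,\dots,r\}\text{ with }s_i\le n_i<t_i\}$. For $\mathcal Q\subseteq\{1,\dots,r\}$, a $\mathcal Q$-domain in $\mathbb Z^r$ is a set $\mathbb X(\mathbf s,\mathbf t)$ with $\mathbf s\le\mathbf t$ and $\mathcal P(\mathbf t-\mathbf s)\subseteq\mathcal Q$. $H^i_{\mathfrak b}(M)$ is local cohomology with its natural $\mathbb Z^r$-grading. The $\mathcal Q$-finiteness dimension $g^{\mathcal Q}_{\mathfrak b}(M)$ is the supremum of the set of $k\in\mathbb N_0$ such that for all $i<k$ there exists a $\mathcal Q$-domain $\mathbb X_i$ in $\mathbb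 Z^r$ with $\mathcal S(H^i_{\mathfrak b}(M))\subseteq\mathbb X_i$, if this supremum exists, and $\infty$ otherwise. *)

(* Defs.v *)
From HB Require Import structures.
From mathcomp Require Import all_boot all_order all_algebra.
From mathcomp Require Import boolp classical_sets.

Set Implicit Arguments.
Unset Strict Implicit.
Unset Printing Implicit Defensive.

Import GRing.Theory.
Local Open Scope ring_scope.
Local Open Scope classical_set_scope.
Local Open Scope quotient_scope.

Local Notation "{ 'quot' B }" := (Quotient.quot B) : type_scope.

Notation zvec r := {ffun 'I_r -> int}.

Definition zle r (n m : zvec r) : Prop := forall i, n i <= m i.

Definition unit_zvec r (i : 'I_r) : zvec r := [ffun j => (j == i)%:R].

Definition posupp r (n : zvec r) : set 'I_r := [set i | n i != 0].

Definition Xdom r (s t : zvec r) : set (zvec r) :=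
  [set n | exists i, s i <= n i < t i].

Definition Qdomain r (Q : set 'I_r) (X : set (zvec r)) : Prop :=
  exists s t, [/\ zle s t, posupp (t - s) `<=` Q & X = Xdom s t].

Definition submodule (R : pzRingType) (V : lmodType R) (N : set V) : Prop :=
  submod_closed [in N].

Definition span_mod (R : pzRingType) (V : lmodType R) (S : set V) : set V :=
  smallest (@submodule R V) S.

Definition fin_gen (R : pzRingType) (V : lmodType R) (N : set V) : Prop :=
  exists s : seq V, N = span_mod [set` s].

Definition ideal (R : pzRingType) : set R -> Prop := @submodule R R^o.

Definition noetherian (R : pzRingType) : Prop :=
  forall I : set R, ideal I -> @fin_gen R R^o I.

Definition ideal_pow (R : pzRingType) (I : set R) (k : nat) : set R :=
  @span_mod R R^o
    [set a | exists2 c : 'I_k -> R, forall j, I (c j) & a = \prod_j c j].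

Definition radical (R : pzRingType) (I : set R) : set R :=
  [set a | exists k : nat, I (a ^+ k)].

Definition annihilator (R : pzRingType) (V : lmodType R) : set R :=
  [set a | forall x : V, a *: x = 0].

(* V is the internal direct sum of the subgroups G n. *)
Definition is_grading r (V : zmodType) (G : zvec r -> set V) : Prop :=
  [/\ forall n, zmod_closed [in G n],
      forall x, exists (s : seq (zvec r)) (c : zvec r -> V),
        (forall n, G n (c n)) /\ x = \sum_(n <- s) c n
    & forall (s : seq (zvec r)) (c : zvec r -> V),
        uniq s -> (forall n, G n (c n)) -> \sum_(n <- s) c n = 0 ->
        forall n, n \in s -> c n = 0].

Definition graded_subset r (V : zmodType) (G : zvec r -> set V) (N : set V) :
    Prop :=
  forall x, N x -> exists (s : seq (zvec r)) (c : zvec r -> V),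
    (forall n, G n (c n) /\ N (c n)) /\ x = \sum_(n <- s) c n.

Definition graded_ring r (R : pzRingType) (gR : zvec r -> set R) : Prop :=
  [/\ is_grading gR, gR 0 1
    & forall m n a c, gR m a -> gR n c -> gR (m + n) (a * c)].

Definition positively_graded r (R : pzRingType) (gR : zvec r -> set R) : Prop :=
  forall n, ~ zle 0 n -> gR n = [set 0].

(* R = R_0[R_{e_1}, ..., R_{e_r}] *)
Definition standard r (R : pzRingType) (gR : zvec r -> set R) : Prop :=
  forall A : set R, subring_closed [in A] ->
    gR 0 `<=` A -> (forall i, gR (unit_zvec i) `<=` A) -> A = setT.

Record grmod r (R : pzRingType) (gR : zvec r -> set R) := GrMod {
  gmod :> lmodType R;
  gcomp : zvec r -> set gmod;
  gmodP : is_grading gcomp;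
  gscaleP : forall m n a x, gR m a -> gcomp n x -> gcomp (m + n) (a *: x)
}.

Definition supp r (V : zmodType) (G : zvec r -> set V) : set (zvec r) :=
  [set n | exists x, G n x /\ x <> 0].

Definition gr_hom r (R : pzRingType) (gR : zvec r -> set R) (A B : grmod gR)
    (h : A -> B) : Prop :=
  forall n x, gcomp n x -> gcomp n (h x).

(* Injective object of the category of Z^r-graded modules and degree-preserving
   homomorphisms. *)
Definition gr_injective r (R : pzRingType) (gR : zvec r -> set R)
    (E : grmod gR) : Prop :=
  forall (A B : grmod gR) (u : {linear A -> B}) (h : {linear A -> E}),
    gr_hom u -> injective u -> gr_hom h ->
    exists2 k : {linear B -> E}, gr_hom k & forall x, k (u x) = h x.

Record inj_resolution r (R : pzRingType) (gR : zvec r -> set R)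
    (M : grmod gR) := InjResolution {
  res_obj :> nat -> grmod gR;
  res_d : forall i, {linear res_obj i -> res_obj i.+1};
  res_aug : {linear M -> res_obj 0%N};
  res_obj_inj : forall i, gr_injective (res_obj i);
  res_d_hom : forall i, gr_hom (res_d i);
  res_aug_hom : gr_hom res_aug;
  res_aug_inj : injective res_aug;
  res_exact0 : forall x, res_d 0%N x = 0 <-> exists y, x = res_aug y;
  res_exact : forall i x, res_d i.+1 x = 0 <-> exists y, x = res_d i y
}.
Arguments res_d {r R gR M} _ i.

Section Subquotient.
Variables (R : pzRingType) (V : lmodType R).

Record submod := Submod { smset : set V; smsetP : submodule smset }.

Definition smpred (N : submod) : {pred V} := [in smset N].
HB.instance Definition _ (N : submod) :=
  GRing.isSubmodClosed.Build R V (smpred N)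
    (GRing.submod_closed_semi (smsetP N : submod_closed (smpred N))).

Definition submod_type (N : submod) : Type := {x : V | x \in smpred N}.
HB.instance Definition _ (N : submod) := SubChoice.on (submod_type N).
HB.instance Definition _ (N : submod) :=
  [SubChoice_isSubLmodule of submod_type N by <:].

Definition lquot (B : submod) : Type := {quot (smpred B)}.
HB.instance Definition _ (B : submod) := GRing.Zmodule.on (lquot B).

Section Scale.
Variable B : submod.

Definition lquot_scale (a : R) (x : lquot B) : lquot B :=
  \pi_{quot (smpred B)} (a *: repr (x : {quot (smpred B)})).

Lemma lquot_scale_pi a (x : V) :
  lquot_scale a (\pi_{quot (smpred B)} x) = \pi_{quot (smpred B)} (a *: x).
Proof.
apply/eqP; rewrite /lquot_scale -Quotient.idealrBE -scalerBr rpredZ //.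
by rewrite Quotient.idealrBE reprK.
Qed.

Lemma lquot_ind (P : lquot B -> Prop) :
  (forall x, P (\pi_{quot (smpred B)} x)) -> forall x, P x.
Proof. by move=> Ppi x; rewrite -[x](@reprK _ {quot (smpred B)}). Qed.

Lemma lquot_scaleA a c x :
  lquot_scale a (lquot_scale c x) = lquot_scale (a * c) x.
Proof. by elim/lquot_ind: x => x; rewrite !lquot_scale_pi scalerA. Qed.

Lemma lquot_scale1 : left_id 1 lquot_scale.
Proof. by elim/lquot_ind=> x; rewrite lquot_scale_pi scale1r. Qed.

Lemma lquot_scaleDr : right_distributive lquot_scale +%R.
Proof.
move=> a; elim/lquot_ind=> x; elim/lquot_ind=> y.
by rewrite -raddfD !lquot_scale_pi scalerDr raddfD.
Qed.

Lemma lquot_scaleDl x : {morph lquot_scale^~ x : a c / a + c}.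
Proof.
move=> a c; elim/lquot_ind: x => x.
by rewrite !lquot_scale_pi scalerDl raddfD.
Qed.

HB.instance Definition _ := GRing.Zmodule_isLmodule.Build R (lquot B)
  lquot_scaleA lquot_scale1 lquot_scaleDr lquot_scaleDl.

End Scale.
End Subquotient.

Section SubquotientType.
Variables (R : pzRingType) (V : lmodType R) (Z B : submod V).

Fact sub_restr_closed : submodule [set z : submod_type Z | smset B (val z)].
Proof.
have [B0 Blin] := smsetP B; split=> [|a x y]; rewrite !in_setE.
  by change (smset B (val (0 : submod_type Z))); rewrite raddf0 -in_setE.
move=> /= xB yB.
change (smset B (val (a *: x + y : submod_type Z))); rewrite linearP.
by rewrite -in_setE; apply: Blin; rewrite in_setE.
Qed.

(* Z / (B :&: Z), where the use below has B contained in Z. *)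
Definition subquot : lmodType R := lquot (Submod sub_restr_closed).

Definition subquot_pi (z : submod_type Z) : subquot :=
  \pi_{quot (smpred (Submod sub_restr_closed))} z.

Definition subquot_comp r (G : zvec r -> set V) (n : zvec r) : set subquot :=
  subquot_pi @` [set z | G n (val z)].

End SubquotientType.

Lemma span_mod_closed (R : pzRingType) (V : lmodType R) (S : set V) :
  submodule (span_mod S).
Proof.
split=> [|a x y]; rewrite !inE.
  by move=> N [[/[!inE]]].
move=> Sx Sy N NS; have [[_ Nlin] _] := NS.
by have := Nlin a x y; rewrite !inE; apply; [exact: Sx|exact: Sy].
Qed.

Section Torsion.
Variables (R : comPzRingType) (b : set R).

Definition torsion (V : lmodType R) : set V :=
  [set x | exists k, forall a, ideal_pow b k a -> a *: x = 0].

Lemma ideal_pow_addl k l : ideal_pow b (k + l) `<=` ideal_pow b k.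
Proof.
apply: smallest_sub; first exact: span_mod_closed.
move=> _ [c bc ->]; rewrite big_split_ord /= mulrC.
have [_ lin] : submodule (ideal_pow b k : set R^o) := span_mod_closed _.
have [I0 _] : submodule (ideal_pow b k : set R^o) := span_mod_closed _.
rewrite -[_ * _]addr0.
have := lin (\prod_(i < l) c (rshift k i)) (\prod_(i < k) c (lshift l i)) 0.
rewrite !inE; apply; last by rewrite inE in I0.
by apply: sub_gen_smallest; exists (fun i => c (lshift l i)).
Qed.

Lemma torsion_closed (V : lmodType R) : submod_closed [in @torsion V].
Proof.
split=> [|a x y]; rewrite !inE; first by exists 0%N => a _; rewrite scaler0.
move=> [k xk] [l yl]; exists (k + l)%N => c cP.
rewrite scalerDr scalerA mulrC -scalerA xk ?scaler0; last exact: ideal_pow_addl cP.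
by rewrite yl ?addr0 //; apply: (@ideal_pow_addl l k); rewrite addnC.
Qed.

Variables (r : nat) (gR : zvec r -> set R) (M : grmod gR).
Variables (I : inj_resolution M) (i : nat).

Fact cocycle_closed :
  submodule (@torsion (I i) `&` [set x | res_d I i x = 0]).
Proof.
have [t0 tlin] := @torsion_closed (I i).
split=> [|a x y]; rewrite !inE /=.
  by rewrite inE in t0; rewrite raddf0.
move=> [tx dx] [ty dy]; split; last by rewrite linearP dx dy scaler0 addr0.
by have := tlin a x y; rewrite !inE; apply.
Qed.

Definition cocycle : submod (I i) := Submod cocycle_closed.

Definition boundary_set (n : nat) : set (I n) :=
  match n with
  | 0 => [set 0]
  | j.+1 => res_d I j @` @torsion (I j)
  end.

Fact boundary_closed : submodule (@boundary_set i).
Proof.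
case: i => [|j] /=.
  by split=> [|a x y]; rewrite !inE //= => -> ->; rewrite scaler0 addr0.
have [t0 tlin] := @torsion_closed (I j).
split=> [|a x y]; rewrite !inE.
  by exists 0; rewrite ?raddf0 //; rewrite inE in t0.
move=> [u tu <-] [v tv <-]; exists (a *: u + v); last by rewrite linearP.
by have := tlin a u v; rewrite !inE; apply.
Qed.

Definition boundary : submod (I i) := Submod boundary_closed.

(* H^i_b(M) as the i-th cohomology of the b-torsion of I: the right derived
   functors of b-torsion on graded modules, which carry the natural grading
   loc_coh_comp.  Any two resolutions of M give isomorphic graded modules. *)
Definition loc_coh : lmodType R := subquot cocycle boundary.

Definition loc_coh_comp : zvec r -> set loc_coh :=
  subquot_comp (Z := cocycle) (B := boundary) (@gcomp r R gR (I i)).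

End Torsion.
Arguments loc_coh {R} b {r gR M} I i.
Arguments loc_coh_comp {R} b {r gR M} I i n _.

Section FinitenessDimension.
Variables (R : comPzRingType) (b : set R).
Variables (r : nat) (gR : zvec r -> set R) (M : grmod gR).
Variables (I : inj_resolution M) (Q : set 'I_r).

Definition findim_set : set nat :=
  [set k | forall i, (i < k)%N ->
     exists2 X, Qdomain Q X & supp (loc_coh_comp b I i) `<=` X].

(* The Q-finiteness dimension; None stands for infinity. *)
Definition findim : option nat :=
  if `[< supremums findim_set !=set0 >]
  then Some (supremum 0%N findim_set) else None.

End FinitenessDimension.

Arguments findim {R} b {r gR M} I Q.

Definition le_natinfty (f : nat) (g : option nat) : Prop :=
  if g is Some k then (f <= k)%N else True.

(* Main.v *)
(* All implications but (i) => (iii) are elementary; in (iii) => (i), multiplying by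
   R_m moves every degree out of X after a bounded number of steps.

   For (i) => (iii), let J be the given graded injective resolution of M, and write
   b = (x_1, ..., x_q) and (R_m) = (a_1, ..., a_l) with homogeneous generators.  If
   a power a^N kills H^i_b for i < f, then H^i_b of the shifted cone of a^N maps onto
   H^i_b(J) for i < f.  Iterating over the a_j replaces J by a Koszul-type complex
   whose cohomology is still finitely generated and is killed by powers of all a_j.
   As R is standard, this cohomology is killed by R_n for all n >= K m, hence
   supported in a P(m)-domain X.  Finally, passing to the torsion of x_1, ..., x_q
   one generator at a time does not enlarge X.  This step needs no more of
   injectivity than that E -> E_x is onto, even on the elements killed by a given
   graded ideal; this property is inherited by cones, so that no further injective
   resolutions have to be constructed. *)
Require Import Defs.
From HB Require Import structures.
From mathcomp Require Import all_boot all_order all_algebra.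
From mathcomp Require Import boolp classical_sets.
From mathcomp Require Import zify.

Set Implicit Arguments.
Unset Strict Implicit.
Unset Printing Implicit Defensive.

Import Order.TTheory GRing.Theory Num.Theory.
Local Open Scope ring_scope.
Local Open Scope classical_set_scope.

(** Local cohomology modules need not be finitely generated, so nilpotence of [R_m] on them does not
    bound degrees by itself; bounds come from finite lists of generators. Finite generation is
    therefore carried only for the cohomology of the complex without torsion, whereas hypothesis (i)
    concerns only the torsion cohomology. A cone on a^N connects the two: a becomes nilpotent on the
    cohomology without torsion as well. The domain X of the last complex descends unchanged through
    all the cones, so their degree shifts need no bookkeeping. No cohomology quotient is formed for
    these complexes: submodules are families of sets indexed by degree, and vanishing of a class is
    membership in [boundaries]. *)

Definition addsub (V : zmodType) (N : set V) : Prop :=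
  N 0 /\ forall x y, N x -> N y -> N (x - y).

Section Addsub.
Variables (V : zmodType) (N : set V) (HN : addsub N).

Lemma addsub0 : N 0. Proof. exact: HN.1. Qed.

Lemma addsubB x y : N x -> N y -> N (x - y). Proof. exact: HN.2. Qed.

Lemma addsubN x : N x -> N (- x).
Proof. by move=> Nx; rewrite -sub0r; apply: addsubB => //; apply: addsub0. Qed.

Lemma addsubD x y : N x -> N y -> N (x + y).
Proof. by move=> Nx Ny; rewrite -[y]opprK; apply/addsubB/addsubN. Qed.

Lemma addsub_sum (J : Type) (s : seq J) (F : J -> V) :
  (forall j, N (F j)) -> N (\sum_(j <- s) F j).
Proof.
by move=> NF; apply: (big_ind N) => //; [apply: addsub0 | apply: addsubD].
Qed.

Lemma addsubMn x k : N x -> N (x *+ k).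
Proof.
move=> Nx; elim: k => [|k IHk]; first by rewrite mulr0n; apply: addsub0.
by rewrite mulrS; apply: addsubD.
Qed.

End Addsub.

Lemma zmod_closedP (V : zmodType) (N : set V) :
  zmod_closed [in N] <-> addsub N.
Proof.
split=> [[N0 NB]|[N0 NB]]; split; rewrite ?in_setE //.
- by rewrite in_setE in N0.
- by move=> x y Nx Ny; have := NB x y; rewrite !inE; apply.
- by move=> x y; rewrite !inE; apply: NB.
Qed.

Lemma submoduleP (R : pzRingType) (V : lmodType R) (N : set V) :
  submodule N <-> addsub N /\ forall a x, N x -> N (a *: x).
Proof.
split=> [[N0 NL]|[[N0 NB] NZ]].
  have N0' : N 0 by rewrite inE in N0.
  have lin a x y : N x -> N y -> N (a *: x + y).
    by move=> Nx Ny; have := NL a x y; rewrite !inE; apply.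
  split=> [|a x Nx]; last by rewrite -[_ *: _]addr0; apply: lin.
  by split=> // x y Nx Ny; rewrite addrC -scaleN1r; apply: lin.
split=> [|a x y]; rewrite !inE // => Nx Ny.
by apply: addsubD => //; apply: NZ.
Qed.

(** * Gradings *)

Section Gradings.
Variables (r : nat) (V : zmodType) (G : zvec r -> set V).
Hypothesis gG : is_grading G.

Lemma grading_addsub n : addsub (G n).
Proof. by apply/zmod_closedP; case: gG. Qed.

(** Unlike in [is_grading], [c] must vanish off a duplicate-free list, which makes it unique as a
    function. *)
Definition decomposes (x : V) (c : zvec r -> V) : Prop :=
  (forall n, G n (c n)) /\
  exists s, [/\ uniq s, forall n, n \notin s -> c n = 0 & x = \sum_(n <- s) c n].

Lemma decomposes_ex x : exists c, decomposes x c.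
Proof.
have [_ /(_ x)[s [c [Gc ->]]] _] := gG.
(* The list given by [is_grading] may repeat a degree; each repetition counts once more. *)
exists (fun n => c n *+ count_mem n s); split=> [n|].
  exact: addsubMn (grading_addsub n) _ _ (Gc n).
exists (undup s); split=> [|n|]; first exact: undup_uniq.
  by rewrite mem_undup => /count_memPn ->.
by rewrite -[LHS]big_undup_iterop_count; apply: eq_bigr.
Qed.

Lemma sum_support (s t : seq (zvec r)) (c : zvec r -> V) :
  uniq s -> uniq t -> {subset s <= t} -> (forall n, n \notin s -> c n = 0) ->
  \sum_(n <- t) c n = \sum_(n <- s) c n.
Proof.
move=> us ut st c0; rewrite (bigID (mem s)) /= [X in _ + X]big1 ?addr0 //.
rewrite -big_filter; apply/perm_big/uniq_perm => //; first exact: filter_uniq.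
by move=> n; rewrite mem_filter andb_idr //; apply: st.
Qed.

Lemma decomposes_uniq x c c' : decomposes x c -> decomposes x c' -> c =1 c'.
Proof.
move=> [Gc [s [us cs xs]]] [Gc' [t [ut ct xt]]] n; have [_ _ U] := gG.
pose u := undup (s ++ t).
have [nu|] := boolP (n \in u); last first.
  by rewrite mem_undup mem_cat negb_or => /andP[/cs -> /ct ->].
apply/eqP; rewrite -subr_eq0; apply/eqP.
apply: (U u (fun k => c k - c' k)) nu; first exact: undup_uniq.
  by move=> k; apply: addsubB (grading_addsub k) _ _ _ _.
rewrite sumrB (@sum_support s) ?undup_uniq //; last first.
  by move=> k ks; rewrite mem_undup mem_cat ks.
rewrite (@sum_support t _ c') ?undup_uniq //; last first.
  by move=> k ks; rewrite mem_undup mem_cat ks orbT.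
by rewrite -xs -xt subrr.
Qed.

Definition gproj (x : V) : zvec r -> V := projT1 (cid (decomposes_ex x)).

Lemma gprojP x : decomposes x (gproj x).
Proof. by rewrite /gproj; case: cid. Qed.

Lemma gproj_in x n : G n (gproj x n).
Proof. by case: (gprojP x). Qed.

Lemma gproj_eq x c : decomposes x c -> gproj x =1 c.
Proof. exact/decomposes_uniq/gprojP. Qed.

Lemma gproj_sum x : exists2 s, uniq s & x = \sum_(n <- s) gproj x n.
Proof. by have [_ [s [us _ E]]] := gprojP x; exists s. Qed.

Lemma gprojB x y n : gproj (x - y) n = gproj x n - gproj y n.
Proof.
apply: (gproj_eq (c := fun n => gproj x n - gproj y n)); split=> [k|].
  by apply: addsubB (grading_addsub k) _ _ _ _; apply: gproj_in.
have [_ [s [us cs xs]]] := gprojP x; have [_ [t [ut ct xt]]] := gprojP y.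
exists (undup (s ++ t)); split=> [|k|]; first exact: undup_uniq.
  by rewrite mem_undup mem_cat negb_or => /andP[/cs -> /ct ->]; rewrite subrr.
rewrite sumrB (@sum_support s) ?undup_uniq //; last first.
  by move=> k ks; rewrite mem_undup mem_cat ks.
rewrite (@sum_support t _ (gproj y)) ?undup_uniq //; last first.
  by move=> k ks; rewrite mem_undup mem_cat ks orbT.
by rewrite -xs -xt.
Qed.

Lemma gproj_homog n x k : G n x -> gproj x k = if k == n then x else 0.
Proof.
move=> Gx; apply: (gproj_eq (c := fun k => if k == n then x else 0)).
split=> [j|]; first by case: eqP => [->|_] //; apply: addsub0 (grading_addsub j).
exists [:: n]; split=> // [j|]; first by rewrite inE; case: eqP.
by rewrite big_seq1 eqxx.
Qed.

Lemma gproj_id n x : G n x -> gproj x n = x.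
Proof. by move=> /(gproj_homog n); rewrite eqxx. Qed.

Lemma gproj0 n : gproj 0 n = 0.
Proof. exact: gproj_id (addsub0 (grading_addsub n)). Qed.

Lemma gprojD x y n : gproj (x + y) n = gproj x n + gproj y n.
Proof.
have N : gproj (- y) n = - gproj y n by rewrite -sub0r gprojB gproj0 sub0r.
by rewrite -[y in LHS]opprK gprojB N opprK.
Qed.

Lemma gproj_bigsum (J : Type) (s : seq J) (F : J -> V) n :
  gproj (\sum_(j <- s) F j) n = \sum_(j <- s) gproj (F j) n.
Proof.
elim: s => [|j s IHs]; first by rewrite !big_nil gproj0.
by rewrite !big_cons gprojD IHs.
Qed.

End Gradings.

(** A decomposition of [x] is carried by [h] to one of [h x] with all degrees moved by [p]. Used
    with p = 0 for differentials, and with [p] the degree of a homogeneous factor for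
    multiplications. *)
Lemma gproj_morph r (V W : zmodType) (G : zvec r -> set V) (H : zvec r -> set W)
    (gG : is_grading G) (gH : is_grading H) (h : V -> W) (p : zvec r) :
  {morph h : x y / x + y} -> (forall n x, G n x -> H (n + p) (h x)) ->
  forall x n, gproj gH (h x) (n + p) = h (gproj gG x n).
Proof.
move=> hD hG x n.
have h0 : h 0 = 0 by apply: (addrI (h 0)); rewrite -hD !addr0.
have hs (s : seq (zvec r)) (F : zvec r -> V) :
    h (\sum_(j <- s) F j) = \sum_(j <- s) h (F j).
  by elim: s => [|j s IHs]; rewrite ?big_nil ?h0 // !big_cons hD IHs.
have [_ [s [us cs xs]]] := gprojP gG x.
rewrite [in LHS]xs hs gproj_bigsum.
under eq_bigr => j _ do
  rewrite (gproj_homog gH _ (hG _ _ (gproj_in gG x j))) (inj_eq (addIr p)).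
have [ns|ns] := boolP (n \in s).
  rewrite (bigD1_seq n) //= eqxx big1 ?addr0 // => j jn.
  by rewrite eq_sym (negPf jn).
rewrite cs // h0 big1_seq // => j /andP[_ js]; case: eqP => // nj.
by rewrite nj js in ns.
Qed.

Lemma subrACA (V : zmodType) (x y z t : V) :
  x - y - (z - t) = x - z - (y - t).
Proof. by rewrite !opprB addrACA [RHS]addrACA [X in _ = _ + X]addrC. Qed.

(** * Spans and graded Noetherianity *)

Section Span.
Variables (R : pzRingType) (V : lmodType R).
Implicit Types (S N : set V) (s : seq V).

Lemma span_addsub S : addsub (span_mod S).
Proof. exact: ((submoduleP _).1 (span_mod_closed S)).1. Qed.

Lemma spanZ S a x : span_mod S x -> span_mod S (a *: x).
Proof. exact: ((submoduleP _).1 (span_mod_closed S)).2. Qed.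

Lemma span_sub S : S `<=` span_mod S.
Proof. exact: sub_gen_smallest. Qed.

Lemma span_min S N : addsub N -> (forall a x, N x -> N (a *: x)) ->
  S `<=` N -> span_mod S `<=` N.
Proof.
move=> NA NZ SN; apply: smallest_sub SN; apply: (submoduleP _).2.
exact: conj NA NZ.
Qed.

Lemma span_mono S T : S `<=` T -> span_mod S `<=` span_mod T.
Proof.
move=> ST; apply: span_min (span_addsub T) (@spanZ T) _.
exact: subset_trans ST (@span_sub T).
Qed.

Lemma span_nil x : span_mod [set` [::] : seq V] x -> x = 0.
Proof.
apply: (@span_min _ [set 0]) => [|a _ ->|y //]; last by rewrite /= scaler0.
by split=> // _ _ -> ->; rewrite /= subr0.
Qed.

Lemma span_consP z s x : span_mod [set` z :: s] x ->
  exists a, span_mod [set` s] (x - a *: z).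
Proof.
apply: (@span_min _ [set x | exists a, span_mod [set` s] (x - a *: z)]).
- split=> [|x1 x2 [a1 h1] [a2 h2]].
    by exists 0; rewrite scale0r subr0; apply: addsub0 (span_addsub _).
  exists (a1 - a2); rewrite scalerBl subrACA.
  exact: addsubB (span_addsub _) _ _ _ _.
- by move=> a y [c hc]; exists (a * c); rewrite -scalerA -scalerBr; apply: spanZ.
- move=> y /=; rewrite inE => /orP[/eqP ->|ys].
    by exists 1; rewrite scale1r subrr; apply: addsub0 (span_addsub _).
  by exists 0; rewrite scale0r subr0; apply: span_sub.
Qed.

Lemma span_finite S x : span_mod S x ->
  exists2 s : seq V, [set` s] `<=` S & span_mod [set` s] x.
Proof.
apply: (@span_min _
  [set x | exists2 s : seq V, [set` s] `<=` S & span_mod [set` s] x]).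
- split=> [|y z [s sS sy] [t tS tz]].
    by exists [::] => //; apply: addsub0 (span_addsub _).
  exists (s ++ t); first by move=> u /=; rewrite mem_cat => /orP[/sS|/tS].
  apply: addsubB (span_addsub _) _ _ _ _.
    by apply: (span_mono _ sy) => u /= us; rewrite mem_cat us.
  by apply: (span_mono _ tz) => u /= us; rewrite mem_cat us orbT.
- by move=> a y [s sS sy]; exists s => //; apply: spanZ.
- move=> y Sy; exists [:: y]; first by move=> u /=; rewrite inE => /eqP ->.
  by apply: span_sub; rewrite /= inE.
Qed.

(** Each given generator involves only finitely many elements of [S]. Applied to sets of homogeneous
    elements, this yields homogeneous generators. *)
Lemma fin_gen_sub S : fin_gen (span_mod S) ->
  exists2 s : seq V, [set` s] `<=` S & S `<=` span_mod [set` s].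
Proof.
move=> [t tE].
have : [set` t] `<=` span_mod S by rewrite tE; apply: span_sub.
suff sub (u : seq V) : [set` u] `<=` span_mod S ->
    exists2 s : seq V, [set` s] `<=` S & [set` u] `<=` span_mod [set` s].
  move=> /sub[s sS ts]; exists s => // x /(@span_sub S); rewrite tE.
  exact: span_min (span_addsub _) (@spanZ _) ts x.
elim: u => [_|x u IHu xuS]; first by exists [::].
have [s1 s1S xs1] : exists2 s : seq V, [set` s] `<=` S & span_mod [set` s] x.
  by apply: span_finite; apply: xuS; apply: mem_head.
have [s2 s2S us2] : exists2 s : seq V, [set` s] `<=` S &
    [set` u] `<=` span_mod [set` s].
  by apply: IHu => y yu; apply: xuS; apply: mem_behead.
exists (s1 ++ s2); first by move=> y /=; rewrite mem_cat => /orP[/s1S|/s2S].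
move=> y /=; rewrite inE => /orP[/eqP ->|/us2].
  by apply: (span_mono _ xs1) => z /= zs; rewrite mem_cat zs.
by apply: (span_mono _) => z /= zs; rewrite mem_cat zs orbT.
Qed.

End Span.

Lemma noetherian_sub (R : pzRingType) (S : set R) : noetherian R ->
  exists2 s : seq R, [set` s] `<=` S & S `<=` @span_mod R R^o [set` s].
Proof. by move=> /(_ _ (span_mod_closed (S : set R^o))) /fin_gen_sub. Qed.

Lemma tag_degrees (D T : eqType) (P : D -> T -> Prop) (s : seq T) :
  (forall x, x \in s -> exists p, P p x) ->
  exists2 L : seq (D * T), [seq q.2 | q <- L] = s &
    forall p x, (p, x) \in L -> P p x.
Proof.
elim: s => [|x s IHs] sP; first by exists [::].
have [L Ls LP] : exists2 L : seq (D * T), [seq q.2 | q <- L] = s &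
    forall p x, (p, x) \in L -> P p x.
  by apply: IHs => y ys; apply: sP; rewrite inE ys orbT.
have [p Pp] := sP x (mem_head _ _).
exists ((p, x) :: L) => [|q y]; first by rewrite /= Ls.
by rewrite inE => /orP[/eqP[-> ->]|/LP].
Qed.

Section HomogSpan.
Variables (r : nat) (R : comPzRingType) (gR : zvec r -> set R).
Hypothesis R_graded : graded_ring gR.

Lemma gR_grading : is_grading gR. Proof. by case: R_graded. Qed.

Lemma gR1 : gR 0 1. Proof. by case: R_graded. Qed.

Lemma gRM m n a c : gR m a -> gR n c -> gR (m + n) (a * c).
Proof. by case: R_graded => _ _; apply. Qed.

Lemma gR_addsub n : addsub (gR n).
Proof. exact: grading_addsub gR_grading n. Qed.

Lemma gRX p x k : gR p x -> gR (p *+ k) (x ^+ k).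
Proof.
move=> Gx; elim: k => [|k IHk]; first by rewrite mulr0n expr0; apply: gR1.
by rewrite mulrS exprS; apply: gRM.
Qed.

Lemma gprojM_homog p c x n : gR p c ->
  gproj gR_grading (c * x) n = c * gproj gR_grading x (n - p).
Proof.
move=> Gc; rewrite -[n in LHS](subrK p).
apply: (gproj_morph gR_grading gR_grading (h := fun y => c * y)) => [u v|u v Gv].
  by rewrite mulrDr.
by rewrite addrC; apply: gRM.
Qed.

Lemma gprojM c x : exists s, forall n, gproj gR_grading (c * x) n =
  \sum_(k <- s) gproj gR_grading c k * gproj gR_grading x (n - k).
Proof.
have [s _ cs] := gproj_sum gR_grading c; exists s => n.
rewrite [in LHS]cs mulr_suml gproj_bigsum; apply: eq_bigr => k _.
by apply: gprojM_homog; apply: gproj_in.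
Qed.

(** A graded submodule given by its homogeneous parts. [V] itself carries no grading, so cocycles,
    boundaries and their spans all fit. *)
Definition stable (V : lmodType R) (W : zvec r -> set V) : Prop :=
  (forall n, addsub (W n)) /\
  forall m n a x, gR m a -> W n x -> W (m + n) (a *: x).

Section OneModule.
Variables (V : lmodType R).
Implicit Types (B W : zvec r -> set V) (L : seq (zvec r * V)).

Lemma stable0 W n : stable W -> W n 0.
Proof. by move=> [WA _]; apply: addsub0. Qed.

Lemma stableB W n x y : stable W -> W n x -> W n y -> W n (x - y).
Proof. by move=> [WA _]; apply: addsubB. Qed.

Lemma stableD W n x y : stable W -> W n x -> W n y -> W n (x + y).
Proof. by move=> [WA _]; apply: addsubD. Qed.

Lemma stableN W n x : stable W -> W n x -> W n (- x).
Proof. by move=> [WA _]; apply: addsubN. Qed.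

Lemma stableZ W m n a x : stable W -> gR m a -> W n x -> W (m + n) (a *: x).
Proof. by move=> [_]; apply. Qed.

Lemma stableZB W p n a x : stable W -> gR (n - p) a -> W p x -> W n (a *: x).
Proof. by move=> sW Ga Wx; rewrite -[n](subrK p); apply: stableZ. Qed.

(* Homogeneous part of degree n of B plus the span of the pairs
   (degree, element) listed in L. *)
Fixpoint hspan B L (n : zvec r) : set V :=
  if L is (p, z) :: L' then
    [set x | exists2 c, gR (n - p) c & hspan B L' n (x - c *: z)]
  else B n.

Lemma hspan_stable B L : stable B -> stable (hspan B L).
Proof.
move=> sB; elim: L => [//|[p z] L IHL]; split=> [n|m n a x Ga [c Gc xc]] /=.
  split=> [|x y [c Gc xc] [e Ge ye]].
    exists 0; first exact: addsub0 (gR_addsub _).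
    by rewrite scale0r subr0; apply: stable0.
  exists (c - e); first exact: addsubB (gR_addsub _) _ _ _ _.
  by rewrite scalerBl subrACA; apply: addsubB (IHL.1 n) _ _ _ _.
exists (a * c); first by rewrite -addrA; apply: gRM.
by rewrite -scalerA -scalerBr; apply: stableZ.
Qed.

Lemma hspan_base B L n : B n `<=` hspan B L n.
Proof.
elim: L => [//|[p z] L IHL] x Bx; exists 0; first exact: addsub0 (gR_addsub _).
by rewrite scale0r subr0; apply: IHL.
Qed.

Lemma hspan_mem B L p z : stable B -> (p, z) \in L -> hspan B L p z.
Proof.
move=> sB; elim: L => [//|[q y] L IHL]; rewrite inE => /orP[/eqP[-> ->]|/IHL zL].
  exists 1; first by rewrite subrr; apply: gR1.
  by rewrite scale1r subrr; apply: stable0; apply: hspan_stable.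
exists 0; first exact: addsub0 (gR_addsub _).
by rewrite scale0r subr0.
Qed.

Lemma hspan_min B L W : stable W -> (forall n, B n `<=` W n) ->
  (forall p z, (p, z) \in L -> W p z) -> forall n, hspan B L n `<=` W n.
Proof.
move=> sW BW; elim: L => [_ n|[p z] L IHL LW n x [c Gc xc]]; first exact: BW.
rewrite -[x](subrK (c *: z)); apply: stableD => //.
  by apply: IHL xc => q y qy; apply: LW; rewrite inE qy orbT.
by apply: stableZB Gc _ => //; apply: LW; rewrite mem_head.
Qed.

Definition zero_family (n : zvec r) : set V := [set 0].

Lemma zero_stable : stable zero_family.
Proof.
split=> [n|m n a x _ ->]; last exact: scaler0.
by split=> // x y -> ->; rewrite /zero_family /= subr0.
Qed.

(** In degree n, the coefficient of a generator of degree p can be replaced by its component of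
    degree n - p. *)
Lemma span_hspan (G : zvec r -> set V) (gG : is_grading G)
    (GZ : forall m n a x, gR m a -> G n x -> G (m + n) (a *: x)) L :
  (forall p z, (p, z) \in L -> G p z) ->
  forall x, span_mod [set` [seq q.2 | q <- L]] x ->
  forall n, hspan zero_family L n (gproj gG x n).
Proof.
elim: L => [|[p z] L IHL] LG x /=.
  by move=> /span_nil -> n; apply: gproj0.
move=> /span_consP[a /IHL xL] n; exists (gproj gR_grading a (n - p)).
  exact: gproj_in.
rewrite -(@gproj_morph _ _ _ _ _ gR_grading gG (fun a => a *: z) p).
- rewrite subrK -gprojB; apply: xL => q y qy.
  by apply: LG; rewrite inE qy orbT.
- by move=> u v; rewrite scalerDl.
- by move=> k u Gu; apply: GZ => //; apply: LG; rewrite mem_head.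
Qed.

End OneModule.

Hypothesis R_noeth : noetherian R.

(** [noetherian] speaks of ungraded ideals, so the ideal spanned by all [J n] is formed and its
    generators are picked among the homogeneous elements. *)
Lemma graded_ideal_fg (J : zvec r -> set R^o) :
  stable J -> (forall n, J n `<=` gR n) ->
  exists2 L, forall p z, (p, z) \in L -> J p z &
    forall n, J n `<=` hspan (@zero_family R^o) L n.
Proof.
move=> sJ JR.
have [s sS Ss] := noetherian_sub [set x | exists n, J n x] R_noeth.
have [|L Ls LJ] := @tag_degrees (zvec r) R^o J s.
  by move=> x xs; apply: sS.
exists L => // n x Jx; rewrite -(gproj_id gR_grading (JR _ _ Jx)).
apply: span_hspan => [m k a y||]; first exact: gRM.
  by move=> p z /LJ /JR.
by rewrite Ls; apply: Ss; exists n.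
Qed.

(** The usual induction for submodules of finitely generated modules, relative to the base [B]: the
    coefficients of the first generator form a graded ideal, whose generators are lifted to [W]; the
    part of [W] inside [hspan B L] is handled by induction. *)
Lemma hspan_noetherian (V : lmodType R) (B : zvec r -> set V) L :
  stable B -> forall W, stable W -> (forall n, W n `<=` hspan B L n) ->
  exists2 L', forall p z, (p, z) \in L' -> W p z &
    forall n, W n `<=` hspan B L' n.
Proof.
move=> sB; elim: L => [|[p z] L IHL] W sW WL; first by exists [::].
pose J n : set R^o := [set c | gR n c /\
  exists2 w, W (n + p) w & hspan B L (n + p) (w - c *: z)].
have sH := hspan_stable L sB.
have sJ : stable J.
  split=> [n|m n a c Ga [Gc [w Ww wc]]].
    split=> [|c e [Gc [w Ww wc]] [Ge [u Wu ue]]].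
      split; first exact: addsub0 (gR_addsub _).
      exists 0; first exact: stable0.
      by rewrite scale0r subr0; apply: stable0.
    split; first exact: addsubB (gR_addsub _) _ _ _ _.
    exists (w - u); first exact: stableB.
    by rewrite scalerBl subrACA; apply: stableB.
  split; first exact: gRM.
  exists (a *: w); first by rewrite -addrA; apply: stableZ.
  by rewrite -addrA -[_ *: c]/(a * c) -scalerA -scalerBr; apply: stableZ.
have [|LJ LJJ JLJ] := graded_ideal_fg sJ; first by move=> n c [].
have [||L2 L2W WL2] := IHL (fun n => W n `&` hspan B L n).
- split=> [n|m n a x Ga [Wx Hx]]; last by split; apply: stableZ.
  split=> [|x y [Wx Hx] [Wy Hy]]; first by split; apply: stable0.
  by split; apply: stableB.
- by move=> n x [].
have sH0 L0 := hspan_stable L0 (@zero_stable V).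
(* [L1] lifts the generators of [J]: every coefficient in their span is realised, modulo
   [hspan B L], by an element of the span of [L1]. *)
have [L1 L1s L1W] : exists2 L1 : seq (zvec r * V),
    (forall q y, (q, y) \in L1 -> W q y) &
    forall n c, hspan (@zero_family R^o) LJ n c ->
      exists2 w, hspan (@zero_family V) L1 (n + p) w &
        hspan B L (n + p) (w - c *: z).
  elim: LJ LJJ {JLJ} => [_|[q c] LJ IHLJ LJJ].
    exists [::] => // n c ->; exists 0; first by [].
    by rewrite scale0r subr0; apply: stable0.
  have [|L1 L1s L1W] := IHLJ.
    by move=> q' c' h; apply: LJJ; rewrite inE h orbT.
  have [Gc [w Ww wc]] := LJJ _ _ (mem_head _ _).
  exists ((q + p, w) :: L1) => [q' y|n e [a Ga /L1W[u Hu ue]]].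
    by rewrite inE => /orP[/eqP[-> ->] //|]; apply: L1s.
  exists (u + a *: w).
    exists a; last by rewrite addrK.
    by rewrite opprD addrACA subrr addr0.
  have -> : u + a *: w - e *: z = (u - (e - a *: c) *: z) + a *: (w - c *: z).
    rewrite -[a *: c]/(a * c) scalerBl scalerBr scalerA opprB addrACA.
    by rewrite [X in _ = _ + X]addrAC subrr add0r.
  apply: stableD => //; apply: stableZB (sH) _ wc.
  by rewrite opprD addrACA subrr addr0.
exists (L1 ++ L2) => [q y|n x Wx].
  by rewrite mem_cat => /orP[/L1s|/L2W[]].
have sL := hspan_stable (L1 ++ L2) sB.
have [c Gc xc] := WL _ _ Wx.
have [|w Hw wc] := L1W (n - p) c.
  by apply: JLJ; split=> //; exists x; rewrite subrK.
rewrite subrK in Hw wc.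
have W0 k : zero_family k `<=` W k by move=> _ ->; apply: stable0.
(* [w] has the same coefficient at [z] as [x], so x - w falls into the part generated by [L2]. *)
rewrite -[x](subrK w); apply: stableD => //.
  apply: (@hspan_min _ B L2) => // [k|q y qy|]; first exact: hspan_base.
    by apply: hspan_mem => //; rewrite mem_cat qy orbT.
  apply: WL2; split; first by apply: stableB => //; apply: hspan_min Hw.
  rewrite (_ : x - w = (x - c *: z) - (w - c *: z)); first exact: stableB.
  by rewrite subrACA subrr subr0.
apply: hspan_min Hw => // [k _ ->|q y qy]; first exact: stable0.
by apply: hspan_mem => //; rewrite mem_cat qy.
Qed.

End HomogSpan.

(** * Entries of multidegrees *)

Lemma zvecP r (n m : zvec r) : (forall i, n i = m i) -> n = m.
Proof. by move=> nm; apply/ffunP. Qed.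

Section ZvecEntries.
Variables (r : nat) (n m : zvec r) (i : 'I_r).

Lemma zvec0 : (0 : zvec r) i = 0. Proof. by rewrite ffunE. Qed.

Lemma zvecD : (n + m) i = n i + m i. Proof. by rewrite ffunE. Qed.

Lemma zvecN : (- n) i = - n i. Proof. by rewrite ffunE. Qed.

Lemma zvecMn k : (n *+ k) i = n i *+ k.
Proof. by elim: k => [|k IHk]; rewrite ?mulr0n ?mulrS ffunE // IHk. Qed.

Lemma unit_zvecE j : unit_zvec j i = (i == j)%:R.
Proof. by rewrite ffunE. Qed.

Definition zvecE := (zvec0, zvecD, zvecN, zvecMn, unit_zvecE).

End ZvecEntries.

(** * Powers of ideals and standard rings *)

Section PowersOfIdeals.
Variable R : comPzRingType.

(* Induction on the total exponent: for a factor x in s, pass from a to (a : x),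
   which contains x ^+ (p x).-1. *)
Lemma prod_in_ideal (s : seq R) K (a : set R) (p : R -> nat) :
  addsub a -> (forall c x, a x -> a (c * x)) ->
  (forall x, x \in s -> a (x ^+ p x)) -> (\sum_(x <- s) p x < K)%N ->
  forall c : 'I_K -> R, (forall j, @span_mod R R^o [set` s] (c j)) ->
  a (\prod_j c j).
Proof.
elim: K a p => [//|K IHK] a p aA aM ap pK c cs.
rewrite big_ord_recl; set P := \prod_(i < K) _.
apply: (@span_min R R^o [set` s] [set y | a (y * P)]) (cs ord0).
- split=> [|x y]; rewrite /= ?mul0r ?mulrBl; first exact: addsub0.
  exact: addsubB.
- by move=> e x; rewrite /= -[e *: x]/(e * x) -mulrA; apply: aM.
move=> x /= xs; case px: (p x) => [|k].
  by rewrite -[_ * _]mulr1; apply: aM; have := ap x xs; rewrite px expr0.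
pose p' y := if y == x then k else p y.
apply: (IHK [set z | a (x * z)] p') => //.
- split=> [|y z]; rewrite /= ?mulr0 ?mulrBr; first exact: addsub0.
  exact: addsubB.
- by move=> e y; rewrite /= mulrCA; apply: aM.
- move=> y ys; rewrite /p' /=; case: eqP => [->|_]; last exact/aM/ap.
  by rewrite -exprS -px; apply: ap.
- rewrite -ltnS; apply: leq_trans pK; rewrite ltnS.
  rewrite !(big_rem x xs) /= {1}/p' eqxx px addSn ltnS leq_add2l.
  by apply: leq_sum => y _; rewrite /p'; case: eqP => // ->; rewrite px.
Qed.

(** Serves twice: with [a] the annihilator of one element, to compare torsion by powers of [b] with
    torsion by generators, and with [a] an annihilator of cohomology. *)
Lemma ideal_pow_sub (s : seq R) (b a : set R) :
  addsub a -> (forall c x, a x -> a (c * x)) ->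
  b `<=` @span_mod R R^o [set` s] ->
  (forall x, x \in s -> exists k, a (x ^+ k)) ->
  exists K, ideal_pow b K `<=` a.
Proof.
move=> aA aM bs ap.
have /choice[p pP] : forall x, exists k, x \in s -> a (x ^+ k).
  move=> x; have [/ap[k ak]|] := boolP (x \in s); first by exists k.
  by exists 0%N.
exists (\sum_(x <- s) p x).+1; apply: (@span_min R R^o) => //.
move=> _ [c cb ->]; apply: (prod_in_ideal aA aM pP) => // j.
exact: bs (cb j).
Qed.

End PowersOfIdeals.

Section StandardRing.
Variables (r : nat) (R : comPzRingType) (gR : zvec r -> set R).
Hypotheses (R_graded : graded_ring gR) (R_std : standard gR).

(** [standard] only tests subrings; spelling out the subring generated by degree 0 and the unit
    degrees makes it available for induction, with the degree of each product recorded. *)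
Inductive monomial : zvec r -> R -> Prop :=
| Monomial0 x : gR 0 x -> monomial 0 x
| MonomialS i n y x :
    gR (unit_zvec i) y -> monomial n x -> monomial (unit_zvec i + n) (y * x).

Inductive monomial_sum : R -> Prop :=
| MonomialSum0 : monomial_sum 0
| MonomialSumS n z x : monomial n z -> monomial_sum x -> monomial_sum (z + x).

Lemma monomial_deg n x : monomial n x -> gR n x.
Proof. by elim=> // i k y z Gy _; apply: gRM. Qed.

Lemma monomial_ge0 n x : monomial n x -> zle 0 n.
Proof.
elim=> [y _ j //|i k y z _ _ k0 j]; rewrite !zvecE.
by move/(_ j): k0; rewrite !zvecE; case: (j == i) => /=; lia.
Qed.

Lemma monomialN n x : monomial n x -> monomial n (- x).
Proof.
elim=> [y Gy|i k y z Gy _ IH]; last by rewrite -mulrN; apply: MonomialS.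
by apply: Monomial0; apply: addsubN (gR_addsub R_graded 0) _ Gy.
Qed.

Lemma monomialM m n x y : monomial m x -> monomial n y ->
  monomial (m + n) (x * y).
Proof.
move=> mx; elim: mx n y => [a Ga|i k a z Ga _ IH] n y.
  elim=> [c Gc|i k c z Gc _ IH].
    by rewrite addr0; apply: Monomial0; rewrite -[0]addr0; apply: gRM.
  by rewrite mulrCA addrCA; apply: MonomialS.
by move=> my; rewrite -addrA -mulrA; apply: MonomialS => //; apply: IH.
Qed.

Lemma monomial_sum1 n z : monomial n z -> monomial_sum z.
Proof. by move=> mz; rewrite -[z]addr0; apply: MonomialSumS mz MonomialSum0. Qed.

Lemma monomial_sumD x y : monomial_sum x -> monomial_sum y -> monomial_sum (x + y).
Proof.
elim=> [|n z u mz _ IH] sy; first by rewrite add0r.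
by rewrite -addrA; apply: MonomialSumS mz (IH sy).
Qed.

Lemma monomial_sumN x : monomial_sum x -> monomial_sum (- x).
Proof.
elim=> [|n z u mz _ IH]; first by rewrite oppr0; apply: MonomialSum0.
by rewrite opprD; apply: MonomialSumS (monomialN mz) IH.
Qed.

Lemma monomial_sumM x y : monomial_sum x -> monomial_sum y -> monomial_sum (x * y).
Proof.
move=> sx; elim: sx y => [y|m u z mu _ IH y sy].
  by rewrite mul0r => _; apply: MonomialSum0.
rewrite mulrDl; apply: monomial_sumD (IH _ sy).
elim: sy => [|n v t mv _ IHt]; first by rewrite mulr0; apply: MonomialSum0.
by rewrite mulrDr; apply: MonomialSumS (monomialM mu mv) IHt.
Qed.

Lemma monomial_sum_all x : monomial_sum x.
Proof.
suff E : monomial_sum = setT by rewrite E.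
apply: R_std => [||i] /=.
- split=> [|y z|y z]; rewrite !inE.
  + exact: monomial_sum1 (Monomial0 (gR1 R_graded)).
  + by move=> sy sz; apply: monomial_sumD sy (monomial_sumN sz).
  + exact: monomial_sumM.
- by move=> y Gy; apply: monomial_sum1 (Monomial0 Gy).
- move=> y Gy; rewrite -[y]mulr1; apply: monomial_sum1.
  exact: MonomialS Gy (Monomial0 (gR1 R_graded)).
Qed.

Lemma monomial_generate n c (T : set R) : addsub T -> monomial n `<=` T ->
  gR n c -> T c.
Proof.
move=> TA mT Gc; rewrite -(gproj_id (gR_grading R_graded) Gc).
elim: (monomial_sum_all c) => [|k z x mz _ IH].
  by rewrite gproj0; apply: addsub0.
rewrite gprojD; apply: addsubD => //.
rewrite (gproj_homog _ _ (monomial_deg mz)); case: eqP => [E|_].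
  by apply: mT; rewrite E.
exact: addsub0.
Qed.

(** The splitting R_n = R_m R_(n-m) of a standard ring, for a single product. *)
Lemma monomial_split n x m : monomial n x -> zle 0 m -> zle m n ->
  exists x1 x2, [/\ monomial m x1, monomial (n - m) x2 & x = x1 * x2].
Proof.
move=> mx; elim: mx m => [y Gy|i k y z Gy mz IH] m m0 mn.
  have -> : m = 0.
    apply: zvecP => j; move/(_ j): m0; move/(_ j): mn.
    by rewrite !zvecE; lia.
  exists y, 1; rewrite subr0 mulr1; split=> //; apply: Monomial0 => //.
  exact: gR1.
have k0 := monomial_ge0 mz.
(* The leading factor goes to the second part if the rest still covers [m] in coordinate i, and to
   the first part otherwise. *)
have [mi|mi] := lerP (m i) (k i).
  have [|x1 [x2 [m1 m2 ->]]] := IH m m0.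
    move=> j; move/(_ j): mn; rewrite !zvecE.
    by case: eqP => [->|_] /=; move: mi; lia.
  exists x1, (y * x2); rewrite mulrCA; split=> //.
  by rewrite -addrA; apply: MonomialS.
have [||x1 [x2 [m1 m2 ->]]] := IH (m - unit_zvec i).
- move=> j; move/(_ j): mn; move/(_ j): m0; move/(_ j): k0; rewrite !zvecE.
  by case: eqP => [->|_] /=; move: mi; lia.
- by move=> j; move/(_ j): mn; rewrite !zvecE; case: (j == i) => /=; lia.
exists (y * x1), x2; rewrite mulrA; split=> //.
  by rewrite -[m](subrKC (unit_zvec i)); apply: MonomialS.
by move: m2; rewrite opprB addrA [k + _]addrC.
Qed.

(** The use of standardness: [K] factors of degree [m] can be split off one after another from a
    monomial of degree at least K m. *)
Lemma standard_ideal_pow m n K c : zle 0 m -> zle (m *+ K) n -> gR n c ->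
  ideal_pow (gR m) K c.
Proof.
move=> m0 mn; apply: monomial_generate; first exact: span_addsub.
move=> {}c mc.
suff [d [e [dm _ ->]]] : exists (d : 'I_K -> R) e,
    [/\ forall j, gR m (d j), monomial (n - m *+ K) e & c = e * \prod_j d j].
  by apply: spanZ; apply: span_sub; exists d.
elim: K mn => [mn|K IHK mn].
  exists (fun=> 1), c; rewrite mulr0n subr0 big_ord0 mulr1; split=> //.
  by case.
have [|d [e [dm me ->]]] := IHK.
  by move=> j; move/(_ j): mn; move/(_ j): m0; rewrite mulrS !zvecE; lia.
have [|x1 [x2 [m1 m2 ->]]] := monomial_split me m0.
  by move=> j; move/(_ j): mn; rewrite mulrS !zvecE; lia.
exists (fun j => oapp d x1 (unlift ord0 j)), x2; split.
- by move=> j; case: unliftP => //= _; apply: monomial_deg.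
- by rewrite mulrS opprD addrA addrAC.
rewrite big_ord_recl unlift_none /= [x1 * x2]mulrC mulrA.
by congr (_ * _); apply: eq_bigr => j _; rewrite liftK.
Qed.

End StandardRing.

(** * Q-domains *)

Section QDomains.
Variables (r : nat) (Q : set 'I_r).

Lemma Qdomain_empty : Qdomain Q (Xdom 0 0).
Proof. by exists 0, 0; split=> // i; rewrite /posupp /= subrr zvec0. Qed.

Lemma Qdomain_union X Y : Qdomain Q X -> Qdomain Q Y ->
  exists2 Z, Qdomain Q Z & X `<=` Z /\ Y `<=` Z.
Proof.
move=> [s [t [st stQ ->]]] [s' [t' [st' stQ' ->]]].
(* A coordinate outside [Q] has an empty strip in both domains, so its bounds can be reset to 0. *)
pose s2 : zvec r :=
  [ffun i => if `[< Q i >] then Num.min (s i) (s' i) else 0].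
pose t2 : zvec r :=
  [ffun i => if `[< Q i >] then Num.max (t i) (t' i) else 0].
have s2E i : s2 i = if `[< Q i >] then Num.min (s i) (s' i) else 0.
  by rewrite ffunE.
have t2E i : t2 i = if `[< Q i >] then Num.max (t i) (t' i) else 0.
  by rewrite ffunE.
exists (Xdom s2 t2).
  exists s2, t2; split=> // i; first rewrite s2E t2E.
    by move: (st i) (st' i); case: ifP => _ //; lia.
  rewrite /posupp /= zvecD zvecN s2E t2E; case: asboolP => [//|_].
  by rewrite subrr eqxx.
have Qin (u v : zvec r) i n : posupp (v - u) `<=` Q -> u i <= n < v i -> Q i.
  move=> uvQ uv; apply: uvQ; rewrite /posupp /= zvecD zvecN.
  by move: uv; move: (u i) (v i); lia.
split=> n [i ni]; exists i; rewrite s2E t2E.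
  by move: (Qin _ _ _ _ stQ ni) => /asboolT ->; move: ni; lia.
by move: (Qin _ _ _ _ stQ' ni) => /asboolT ->; move: ni; lia.
Qed.

Lemma Qdomain_bigunion (f : nat) (S : nat -> set (zvec r)) :
  (forall i, (i < f)%N -> exists2 X, Qdomain Q X & S i `<=` X) ->
  exists2 X, Qdomain Q X & forall i, (i < f)%N -> S i `<=` X.
Proof.
elim: f => [_|f IHf SX].
  by exists (Xdom 0 0) => //; apply: Qdomain_empty.
have [|X QX SfX] := IHf; first by move=> i /ltnW/SX.
have [Y QY SY] := SX f (ltnSn f).
have [Z QZ [XZ YZ]] := Qdomain_union QX QY.
exists Z => // i; rewrite ltnS leq_eqVlt => /orP[/eqP ->|/SfX SiX].
  exact: subset_trans SY YZ.
exact: subset_trans SiX XZ.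
Qed.

(** Coordinates where [p] vanishes never move and stay outside their strips; in the others, n + k p
    has passed t once k reaches |t_i| + |n_i|. *)
Lemma Qdomain_beyond X n p : Qdomain Q X -> ~ X n -> zle 0 p ->
  exists K, forall k, (K <= k)%N -> ~ X (n + p *+ k).
Proof.
move=> [s [t [_ _ ->]]] nX p0.
pose D i := (`|t i|%N + `|n i|%N)%N.
have DK i : (D i <= \sum_i D i)%N by rewrite (bigD1 i) //= leq_addr.
exists (\sum_i D i)%N => k Dk [i]; rewrite zvecD zvecMn => ni.
have Dik := leq_trans (DK i) Dk; move: (p0 i); rewrite zvec0 => pi0.
have [pi|pi] := eqVneq (p i) 0.
  by apply: nX; exists i; move: ni; rewrite pi mul0rn addr0.
have : p i *+ k >= k%:Z.
  by rewrite -[p i *+ k]mulr_natr natz; move: pi pi0; nia.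
by move: ni Dik; rewrite /D; lia.
Qed.

End QDomains.

(* The k at which n + k m visits one strip s i <= _ < t i are less than D apart,
   so r strips cannot account for all of k = 0, D, ..., r D. *)
Lemma Qdomain_escape r (m : zvec r) X : zle 0 m -> Qdomain (posupp m) X ->
  exists K, forall n, exists2 k, (k <= K)%N & ~ X (n + m *+ k).
Proof.
move=> m0 [s [t [st stQ ->]]].
pose D := (\sum_i `|t i - s i|)%N.
have DK i : (`|t i - s i| <= D)%N by rewrite /D (bigD1 i) //= leq_addr.
exists (r * D)%N => n; apply: contrapT => nk.
have /choice[g gP] (c : 'I_r.+1) : exists i,
    s i <= (n + m *+ (c * D)) i < t i.
  apply: contrapT => ng; apply: nk; exists (c * D)%N; last first.
    by move=> [i ni]; apply: ng; exists i.
  by rewrite leq_mul2r -ltnS ltn_ord orbT.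
have ginj : injective g.
  suff ltg (c e : 'I_r.+1) : (c < e)%N -> g c <> g e.
    move=> c e ce; apply: val_inj.
    by case: (ltngtP (val c) (val e)) => // /ltg; rewrite ce.
  move=> ce gce; move: (gP c) (gP e); rewrite -{}gce; move: (g c) => i.
  rewrite !zvecD !zvecMn => ci ei.
  (* Strip i is not empty, so t - s does not vanish at i, and i lies in [posupp m]. *)
  have mi : 1 <= m i.
    have : posupp m i.
      apply: stQ; rewrite /posupp /= zvecD zvecN.
      by move: ci; move: (s i) (t i); lia.
    by move: (m0 i); rewrite /posupp zvec0 /=; lia.
  have : m i *+ (e * D) >= m i *+ (c * D) + D%:Z.
    rewrite -![m i *+ _]mulr_natr !natz.
    have : (c * D + D <= e * D)%N by rewrite -mulSnr leq_mul2r ce orbT.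
    by move: mi; nia.
  by move: (DK i) ci ei; lia.
by have := leq_card g ginj; rewrite !card_ord ltnn.
Qed.

(** * Torsion in complexes *)

Section Torsion.
Variables (R : comPzRingType) (V : lmodType R).
Implicit Types (xs : seq R) (v w : V).

(** Torsion is tested on each element of [xs] separately instead of on powers of an ideal, so that
    generators can be added one at a time; [torsion_tors] identifies the two notions for generators
    of [b]. *)
Definition tors xs v : Prop := forall x, x \in xs -> exists k, x ^+ k *: v = 0.

Lemma scale_pow_le (x : R) k l v : (k <= l)%N -> x ^+ k *: v = 0 -> x ^+ l *: v = 0.
Proof. by move=> /subnK <- xv; rewrite exprD -scalerA xv scaler0. Qed.

Lemma tors_cons x xs v :
  tors (x :: xs) v <-> (exists k, x ^+ k *: v = 0) /\ tors xs v.
Proof.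
split=> [tv|[xv tv] y].
  split=> [|y ys]; apply: tv; first exact: mem_head.
  by rewrite inE ys orbT.
by rewrite inE => /orP[/eqP ->|/tv].
Qed.

Lemma tors_exponent xs v : tors xs v ->
  exists k, forall x, x \in xs -> x ^+ k *: v = 0.
Proof.
elim: xs => [_|x xs IHxs /tors_cons[[k xv] /IHxs[l xsv]]]; first by exists 0%N.
exists (k + l)%N => y; rewrite inE => /orP[/eqP ->|/xsv].
  by apply: scale_pow_le xv; apply: leq_addr.
by apply: scale_pow_le; apply: leq_addl.
Qed.

Lemma tors_addsub xs : addsub (tors xs).
Proof.
split=> [x _|v w tv tw x xs_x]; first by exists 0%N; rewrite scaler0.
have [[k xv] [l xw]] := (tv x xs_x, tw x xs_x).
exists (k + l)%N; rewrite scalerBr (scale_pow_le _ xv) ?leq_addr //.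
by rewrite (scale_pow_le _ xw) ?leq_addl // subr0.
Qed.

Lemma torsZ xs a v : tors xs v -> tors xs (a *: v).
Proof.
move=> tv x /tv[k xv]; exists k.
by rewrite scalerA mulrC -scalerA xv scaler0.
Qed.

Lemma tors_morph (W : lmodType R) (h : V -> W) xs v : h 0 = 0 ->
  (forall a u, h (a *: u) = a *: h u) -> tors xs v ->
  forall x, x \in xs -> exists k, x ^+ k *: h v = 0.
Proof. by move=> h0 hZ tv x /tv[k xv]; exists k; rewrite -hZ xv h0. Qed.

End Torsion.

Section Complexes.
Variables (r : nat) (R : comPzRingType) (gR : zvec r -> set R).
Hypotheses (R_graded : graded_ring gR) (R_noeth : noetherian R).

Definition homogeneous (x : R) : Prop := exists2 p, zle 0 p & gR p x.

Section Cohomology.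
Variables (V : lmodType R) (d : V -> V) (G : int -> zvec r -> set V).
Implicit Types (xs : seq R) (j f : int).

(** For [xs] empty, these and [boundaries] belong to the complex itself; in general to its
    [xs]-torsion subcomplex, which is why a bounding element has to be torsion as well. *)
Definition cocycles xs j n : set V :=
  [set z | [/\ G j n z, d z = 0 & tors xs z]].

Definition boundaries xs j n : set V :=
  [set z | exists2 y, G (j - 1) n y & tors xs y /\ d y = z].

End Cohomology.

(* A complex is stored as one module with a differential; G j n is its part of
   cohomological degree j and internal degree n.  The field cx_div says that
   localization at x is surjective on elements killed by s, which is all that
   is needed of injective objects. *)
Record complex := Complex {
  cx_mod :> lmodType R;
  cx_d : cx_mod -> cx_mod;
  cx_comp : int -> zvec r -> set cx_mod;
  cx_dB : forall x y, cx_d (x - y) = cx_d x - cx_d y;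
  cx_dZ : forall a x, cx_d (a *: x) = a *: cx_d x;
  cx_dd : forall x, cx_d (cx_d x) = 0;
  cx_stable : forall j, stable gR (cx_comp j);
  cx_d_comp : forall j n x, cx_comp j n x -> cx_comp (j + 1) n (cx_d x);
  cx_neg : forall j n x, j < 0 -> cx_comp j n x -> x = 0;
  cx_div : forall j n p x (s : seq R) w k,
    gR p x -> (forall y, y \in s -> homogeneous y) ->
    cx_comp j n w -> (forall y, y \in s -> y *: w = 0) ->
    exists l w', [/\ cx_comp j (n - p *+ k) w',
      forall y, y \in s -> y *: w' = 0 & x ^+ l *: w = x ^+ (l + k) *: w'];
  cx_fg : forall j, exists2 L,
    forall p z, (p, z) \in L -> cocycles cx_d cx_comp [::] j p z &
    forall n, cocycles cx_d cx_comp [::] j n `<=`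
      hspan gR (boundaries cx_d cx_comp [::] j) L n
}.

Section OneComplex.
Variable C : complex.
Implicit Types (xs : seq R) (j f : int) (X : set (zvec r)).

Local Notation Z := (cocycles (@cx_d C) (@cx_comp C)).
Local Notation B := (boundaries (@cx_d C) (@cx_comp C)).

Lemma cx_d0 : cx_d (0 : C) = 0.
Proof. by rewrite -[0 in LHS](scale0r 0) cx_dZ scale0r. Qed.

Lemma cx_dN (x : C) : cx_d (- x) = - cx_d x.
Proof. by rewrite -sub0r cx_dB cx_d0 sub0r. Qed.

Lemma cx_dj j n (x : C) : cx_comp (j - 1) n x -> cx_comp j n (cx_d x).
Proof. by move=> /cx_d_comp; rewrite subrK. Qed.

Lemma tors_d xs (x : C) : tors xs x -> tors xs (cx_d x).
Proof.
move=> tx y ys; apply: (tors_morph cx_d0 _ tx) ys => a u; exact: cx_dZ.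
Qed.

Lemma boundaries_stable xs j : stable gR (B xs j).
Proof.
have sC := cx_stable C (j - 1); split=> [n|m n a x Ga [y Gy [ty <-]]].
  split=> [|_ _ [y Gy [ty <-]] [u Gu [tu <-]]].
    exists 0; first exact: stable0 sC.
    by split; [exact: addsub0 (tors_addsub _ _) | exact: cx_d0].
  exists (y - u); first exact: stableB sC _ _.
  by split; [exact: addsubB (tors_addsub _ _) _ _ _ _ | rewrite cx_dB].
exists (a *: y); first exact: stableZ sC Ga Gy.
by split; [exact: torsZ | rewrite cx_dZ].
Qed.

(* The cohomology of the xs-torsion is supported in X below degree f. *)
Definition vanish xs f X : Prop :=
  forall j n, j < f -> ~ X n -> Z xs j n `<=` B xs j n.

(** A single exponent for all degrees below [f], so that one cone, on [x ^+ N], serves all of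
    them. *)
Definition cnilp xs f (x : R) : Prop :=
  exists2 p, gR p x & exists N, forall j n z, j < f -> Z xs j n z ->
    B xs j (n + p *+ N) (x ^+ N *: z).

(* A cocycle z = d y killed by a power of x is the boundary of a torsion element
   once x^k y is a boundary d w: divide w by x^k.  That x^k y is a boundary
   follows as n + k deg x stays outside a Q-domain for large k. *)
Lemma vanish_tors Q X xs f x : Qdomain Q X ->
  (forall y, y \in xs -> homogeneous y) -> homogeneous x ->
  vanish xs f X -> vanish (x :: xs) f X.
Proof.
move=> QX xs_hom [p p0 Gx] vX j n jf nX z [Gz dz /tors_cons[[k0 xz] tz]].
have [y Gy [ty dy]] : B xs j n z by apply: vX.
have [K nKX] := Qdomain_beyond QX nX p0.
pose k := (k0 + K)%N.
have [w Gw [tw dw]] : B xs (j - 1) (n + p *+ k) (x ^+ k *: y).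
  apply: vX; [lia|by apply: nKX; rewrite leq_addl|split].
  - by rewrite [n + _]addrC; apply: stableZ (cx_stable C _) (gRX R_graded _ Gx) Gy.
  - by rewrite cx_dZ dy; apply: scale_pow_le xz; apply: leq_addr.
  - exact: torsZ.
have [e ew] := tors_exponent tw.
(* [cx_div] preserves annihilators, not torsion; replacing each element of [xs] by a power that
   kills [w] makes [w'] torsion too. *)
have [||l [w' [Gw' tw' xw]]] := @cx_div C _ _ p x [seq y ^+ e | y <- xs] w k Gx _ Gw.
- move=> _ /mapP[y' /xs_hom[q q0 Gq] ->]; exists (q *+ e).
    by move=> i; move: (q0 i); rewrite zvecMn zvec0 => qi; apply: mulrn_wge0.
  exact: gRX.
- by move=> _ /mapP[y' /ew y'w ->].
rewrite addrK in Gw'.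
have tw'' : tors xs w'.
  by move=> y' y's; exists e; apply: tw'; apply: map_f.
(* Same differential as y, but killed by x^(l+k), because x^(l+k) d w' = x^l d w = x^(l+k) y. *)
exists (y - cx_d w').
  by apply: stableB (cx_stable C _) Gy _; apply: cx_dj.
split; last by rewrite cx_dB cx_dd subr0.
apply/tors_cons; split; last first.
  by apply: addsubB (tors_addsub _ _) _ _ ty _; apply: tors_d.
exists (l + k)%N; rewrite scalerBr -cx_dZ -xw cx_dZ dw scalerA -exprD.
by rewrite subrr.
Qed.

Lemma vanish_tors_all Q X xs f : Qdomain Q X ->
  (forall y, y \in xs -> homogeneous y) ->
  vanish [::] f X -> vanish xs f X.
Proof.
move=> QX; elim: xs => [//|x xs IHxs] xs_hom v0.
have xs_hom' y : y \in xs -> homogeneous y.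
  by move=> ys; apply: xs_hom; rewrite inE ys orbT.
apply: vanish_tors QX _ _ _ => //; last exact: IHxs.
by apply: xs_hom; apply: mem_head.
Qed.

End OneComplex.
End Complexes.

(** * Cones *)

Section Cone.
Variables (r : nat) (R : comPzRingType) (gR : zvec r -> set R).
Hypotheses (R_graded : graded_ring gR) (R_noeth : noetherian R).
Variables (C : complex gR) (a : R) (p : zvec r) (Ga : gR p a).

Local Notation V := (C * C)%type.

(** A cocycle is a cocycle z of [C] paired with some w such that a z = d w, that is, with a reason
    why a kills the class of z. *)
Definition cone_d (x : V) : V := (cx_d x.1, a *: x.1 - cx_d x.2).

(* Indexed so that the complex C sits in its own degree: the mapping cone of a,
   shifted by one. *)
Definition cone_comp (j : int) (n : zvec r) : set V :=
  [set x | cx_comp j n x.1 /\ cx_comp (j - 1) (n + p) x.2].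

Lemma cone_dB x y : cone_d (x - y) = cone_d x - cone_d y.
Proof.
case: x y => [x1 x2] [y1 y2]; congr pair => /=; first exact: cx_dB.
by rewrite cx_dB scalerBr subrACA.
Qed.

Lemma cone_dZ c x : cone_d (c *: x) = c *: cone_d x.
Proof.
case: x => [x1 x2]; congr pair => /=; first exact: cx_dZ.
by rewrite cx_dZ scalerBr !scalerA mulrC.
Qed.

Lemma cone_dd x : cone_d (cone_d x) = 0.
Proof.
case: x => [x1 x2]; congr pair => /=; first exact: cx_dd.
by rewrite cx_dB cx_dd cx_dZ subr0 subrr.
Qed.

Lemma cone_stable j : stable gR (cone_comp j).
Proof.
have [s1 s2] := (cx_stable C j, cx_stable C (j - 1)).
split=> [n|m n c x Gc [G1 G2]]; last first.
  by split; [exact: stableZ s1 Gc G1 | rewrite -addrA; exact: stableZ s2 Gc G2].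
split=> [|x y [x1 x2] [y1 y2]].
  by split; [exact: stable0 s1 | exact: stable0 s2].
by split; [exact: stableB s1 x1 y1 | exact: stableB s2 x2 y2].
Qed.

Lemma cone_d_comp j n x : cone_comp j n x -> cone_comp (j + 1) n (cone_d x).
Proof.
move=> [G1 G2]; split; first exact: cx_d_comp.
rewrite /= addrK; apply: stableB (cx_stable C j) _ _; last exact: cx_dj.
by rewrite addrC; apply: stableZ (cx_stable C j) Ga G1.
Qed.

Lemma cone_neg j n x : j < 0 -> cone_comp j n x -> x = 0.
Proof.
case: x => [x1 x2] j0 [/= G1 G2]; congr pair; first exact: cx_neg j0 G1.
by apply: cx_neg G2; lia.
Qed.

(** The components are divided separately; the identity survives an increase of l, so the sum of the
    two exponents serves both. *)
Lemma cone_div j n q x (s : seq R) w k :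
  gR q x -> (forall y, y \in s -> homogeneous gR y) ->
  cone_comp j n w -> (forall y, y \in s -> y *: w = 0) ->
  exists l w', [/\ cone_comp j (n - q *+ k) w',
    forall y, y \in s -> y *: w' = 0 & x ^+ l *: w = x ^+ (l + k) *: w'].
Proof.
case: w => [w1 w2] Gx s_hom [/= G1 G2] sw.
have sw1 y : y \in s -> y *: w1 = 0 by move=> /sw[].
have sw2 y : y \in s -> y *: w2 = 0 by move=> /sw[].
have [l1 [v1 [H1 sv1 E1]]] := cx_div k Gx s_hom G1 sw1.
have [l2 [v2 [H2 sv2 E2]]] := cx_div k Gx s_hom G2 sw2.
exists (l1 + l2)%N, (v1, v2); split; first by split=> //=; rewrite addrAC.
  by move=> y ys; congr pair; [exact: sv1 | exact: sv2].
have scaleD (l l' : nat) (u v : C) : x ^+ l *: u = x ^+ (l + k) *: v ->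
    x ^+ (l' + l) *: u = x ^+ (l' + l + k) *: v.
  by move=> E; rewrite -addnA !(exprD _ l') -!scalerA E.
congr pair => /=; last exact: scaleD.
by rewrite addnC; apply: scaleD.
Qed.

Local Notation Z := (cocycles (@cx_d _ _ _ C) (@cx_comp _ _ _ C)).
Local Notation B := (boundaries (@cx_d _ _ _ C) (@cx_comp _ _ _ C)).
Local Notation Zc := (cocycles cone_d cone_comp).
Local Notation Bc := (boundaries cone_d cone_comp).

Lemma tors_pair xs (x : V) : tors xs x <-> tors xs x.1 /\ tors xs x.2.
Proof.
case: x => [u v]; split=> [tx|[/= tu tv] y ys].
  by split=> y /tx[k [yu yv]]; exists k.
have [[k yu] [l yv]] := (tu y ys, tv y ys); exists (k + l)%N.
congr pair => /=; first exact: scale_pow_le (leq_addr _ _) yu.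
exact: scale_pow_le (leq_addl _ _) yv.
Qed.

Lemma tors_nil (W : lmodType R) (x : W) : tors [::] x.
Proof. by []. Qed.

Lemma cone_boundaries_stable j : stable gR (Bc [::] j).
Proof.
have sC := cone_stable (j - 1); split=> [n|m n c x Gc [y Gy [_ <-]]].
  split=> [|_ _ [y Gy [_ <-]] [u Gu [_ <-]]].
    exists 0; first exact: stable0 sC.
    by split=> //; rewrite -[0 in LHS](scale0r 0) cone_dZ scale0r.
  by exists (y - u); [exact: stableB sC Gy Gu | rewrite cone_dB].
by exists (c *: y); [exact: stableZ sC Gc Gy | rewrite cone_dZ].
Qed.

(* The cohomology of the cone is an extension of the submodule of H^j(C) killed
   by a, finitely generated by Noetherianity, by a quotient of H^(j-1)(C). *)
Lemma cone_fg j : exists2 L,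
  forall q z, (q, z) \in L -> Zc [::] j q z &
  forall n, Zc [::] j n `<=` hspan gR (Bc [::] j) L n.
Proof.
have [sC sC1] := (cx_stable C j, cx_stable C (j - 1)).
have sBc := cone_boundaries_stable j.
(* Cocycles whose class is killed by [a]: exactly the first components of cone cocycles. *)
pose W n : set C := [set u | [/\ cx_comp j n u, cx_d u = 0 &
  exists2 v, cx_comp (j - 1) (n + p) v & a *: u = cx_d v]].
have sW : stable gR W.
  split=> [n|m n c u Gc [Gu du [v Gv uv]]].
    split=> [|x y [Gx dx [u Gu xu]] [Gy dy [v Gv yv]]].
      split; [exact: stable0 sC | exact: cx_d0 |].
      by exists 0; [exact: stable0 sC1 | rewrite scaler0 cx_d0].
    split; [exact: stableB sC _ _ | by rewrite cx_dB dx dy subrr|].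
    exists (u - v); first exact: stableB sC1 _ _.
    by rewrite scalerBr cx_dB xu yv.
  split; [exact: stableZ sC Gc Gu | by rewrite cx_dZ du scaler0|].
  exists (c *: v); first by rewrite -addrA; exact: stableZ sC1 Gc Gv.
  by rewrite cx_dZ -uv !scalerA mulrC.
have [LC _ ZLC] := cx_fg C j.
have [|L' L'W WL'] := hspan_noetherian R_graded R_noeth
    (boundaries_stable C [::] j) sW (L := LC).
  by move=> n u [Gu du _]; apply: ZLC; split=> //; apply: tors_nil.
have [L1 L1Z L1W] : exists2 L1 : seq (zvec r * V),
    (forall q z, (q, z) \in L1 -> Zc [::] j q z) &
    forall n u, hspan gR (B [::] j) L' n u ->
      exists v, hspan gR (Bc [::] j) L1 n (u, v).
  elim: L' L'W {WL'} => [_|[q z] L' IHL' L'W].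
    (* The boundary d y is the first component of the cone boundary of (y, 0), which is (d y, a
       y). *)
    exists [::] => // n _ [y Gy [_ <-]]; exists (a *: y), (y, 0).
      by split=> //=; apply: stable0 (cx_stable C _).
    by split=> //; congr pair => /=; rewrite cx_d0 subr0.
  have [|L1 L1Z L1W] := IHL'.
    by move=> q' z' h; apply: L'W; rewrite inE h orbT.
  have [Gz dz [v Gv zv]] := L'W _ _ (mem_head _ _).
  exists ((q, (z, v)) :: L1) => [q' z'|n u [c Gc /L1W[v' v'h]]].
    rewrite inE => /orP[/eqP[-> ->]|]; last exact: L1Z.
    split; [by split | by congr pair; rewrite /= ?zv ?subrr | exact: tors_nil].
  exists (v' + c *: v), c => //; congr (hspan _ _ _ _ _): v'h.
  by congr pair; rewrite /= addrK.
have [L2 L2Z ZL2] := cx_fg C (j - 1).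
(* Generators of H^(j-1)(C) enter as second components, whose internal degree exceeds that of the
   pair by [p]. *)
pose L3 : seq (zvec r * V) := [seq (q.1 - p, (0, q.2)) | q <- L2].
have L3Z q z : (q, z) \in L3 -> Zc [::] j q z.
  move=> /mapP[[q' z'] /L2Z[Gz dz _] [-> ->]]; split; last exact: tors_nil.
    by split; [exact: stable0 sC | rewrite /= subrK].
  by congr pair; rewrite /= ?cx_d0 // scaler0 dz subrr.
have L13Z q z : (q, z) \in L1 ++ L3 -> Zc [::] j q z.
  by rewrite mem_cat => /orP[/L1Z|/L3Z].
exists (L1 ++ L3) => // n [u v] [[/= Gu Gv] [du uv] _].
have sH := hspan_stable R_graded (L1 ++ L3) sBc.
have auv : a *: u = cx_d v by apply/eqP; rewrite -subr_eq0 uv.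
have [v' Hv'] : exists v', hspan gR (Bc [::] j) L1 n (u, v').
  by apply: L1W; apply: WL'; split=> //; exists v.
(* Cone cocycles as a stable family, to see that the pair (u, v') built from [L1] is a cocycle;
   hence v - v' is a cocycle of [C]. *)
have sZ : stable gR (fun n => [set x | cone_comp j n x /\ cone_d x = 0]).
  split=> [k|k l c x Gc [Gx dx]].
    split=> [|x y [Gx dx] [Gy dy]].
      split; first exact: stable0 (cone_stable j).
      by rewrite -[0 in LHS](scale0r 0) cone_dZ scale0r.
    split; first exact: stableB (cone_stable j) Gx Gy.
    by rewrite cone_dB dx dy subrr.
  split; first exact: stableZ (cone_stable j) Gc Gx.
  by rewrite cone_dZ dx scaler0.
have BcZ k x : Bc [::] j k x -> cone_comp j k x /\ cone_d x = 0.
  move=> [y Gy [_ <-]]; split; last exact: cone_dd.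
  by rewrite -[j](subrK 1); apply: cone_d_comp.
have L1Z' q z : (q, z) \in L1 -> cone_comp j q z /\ cone_d z = 0 by move=> /L1Z[].
have [[/= _ Gv'] [_ uv']] := hspan_min sZ BcZ L1Z' Hv'.
rewrite -[(u, v)](subrK (u, v')); apply: (stableD sH); last first.
  apply: (hspan_min sH _ _ Hv') => [k|q y qy]; first exact: hspan_base.
  by apply: hspan_mem => //; rewrite mem_cat qy.
have -> : (u, v) - (u, v') = (0, v - v') by congr pair; rewrite /= ?subrr.
pose W2 k : set C := [set y | hspan gR (Bc [::] j) (L1 ++ L3) (k - p) (0, y)].
have sW2 : stable gR W2.
  split=> [k|k l c y Gc Hy].
    split=> [|y1 y2 H1 H2]; first exact: stable0 sH.
    suff E : (0, y1 - y2) = (0, y1) - (0, y2) :> V.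
      by rewrite /W2 /= E; apply: (stableB sH H1 H2).
    by congr pair; rewrite /= subr0.
  suff E : (0, c *: y) = c *: (0, y) :> V.
    by rewrite /W2 /= E -addrA; apply: stableZ sH Gc Hy.
  by congr pair; rewrite /= scaler0.
suff : W2 (n + p) (v - v') by rewrite /W2 /= addrK.
have Hvv' : hspan gR (B [::] (j - 1)) L2 (n + p) (v - v').
  apply: ZL2; split; last exact: tors_nil.
    exact: stableB sC1 Gv Gv'.
  by rewrite cx_dB -auv.
apply: (hspan_min sW2 _ _ Hvv').
  move=> k _ [y Gy [_ <-]]; apply: hspan_base => //; exists (0, - y).
    split; first exact: stable0 (cx_stable C _).
    by rewrite /= subrK; apply: stableN (cx_stable C _) Gy.
  by split=> //; congr pair; rewrite /= ?cx_d0 // scaler0 cx_dN opprK add0r.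
move=> q z qz; apply: hspan_mem => //; rewrite mem_cat; apply/orP; right.
by apply/mapP; exists (q, z).
Qed.

Definition cone : complex gR :=
  @Complex _ _ _ V cone_d cone_comp cone_dB cone_dZ cone_dd cone_stable
    cone_d_comp cone_neg cone_div cone_fg.

End Cone.

(** * Vanishing and nilpotence along a cone *)

Section ConeNilpotence.
Variables (r : nat) (R : comPzRingType) (gR : zvec r -> set R).
Hypotheses (R_graded : graded_ring gR) (R_noeth : noetherian R).
Variables (C : complex gR) (a : R) (p : zvec r) (Ga : gR p a).
Implicit Types (xs : seq R) (f : int).

Local Notation Z := (cocycles (@cx_d _ _ _ C) (@cx_comp _ _ _ C)).
Local Notation B := (boundaries (@cx_d _ _ _ C) (@cx_comp _ _ _ C)).
Local Notation K := (cone R_graded R_noeth C Ga).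

(** A cocycle z lifts to the cone cocycle (z, w) with d w = a z, and the first component of a pair
    bounding (z, w) bounds z. *)
Lemma vanish_cone xs f X :
  (forall j n z, j < f -> Z xs j n z -> B xs j (n + p) (a *: z)) ->
  vanish K xs f X -> vanish C xs f X.
Proof.
move=> aB vX j n jf nX z Zz; have [w Gw [tw dw]] := aB _ _ _ jf Zz.
have [Gz dz tz] := Zz.
have [|[u v] [Gu _] [/tors_pair[tu _] [du _]]] := vX j n jf nX (z, w).
  split; [by split | | by apply/tors_pair].
  by congr pair; rewrite /= ?dz // dw subrr.
by exists u.
Qed.

(** The exponent doubles, as for any extension: the first x^N gives x^N u = d w, which turns x^N v -
    a w into a cocycle of [C] in degree j - 1; the second x^N bounds the latter. *)
Lemma cnilp_cone xs f x : cnilp C xs f x -> cnilp K xs f x.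
Proof.
move=> [q Gx [N xN]]; exists q => //; exists (N + N)%N => j n [u v] jf.
move=> [[/= Gu Gv] [du uv] /tors_pair[/= tu tv]].
have auv : a *: u = cx_d v by apply/eqP; rewrite -subr_eq0 uv.
have Gxn := gRX R_graded N Gx.
have [w Gw [tw dw]] := xN j n u jf (And3 Gu du tu).
have [||w' Gw' [tw' dw']] := xN (j - 1) (n + p + q *+ N) (x ^+ N *: v - a *: w).
- by lia.
- split.
  + apply: (stableB (cx_stable C _)).
      by rewrite [_ + q *+ N]addrC; apply: stableZ (cx_stable C _) Gxn Gv.
    by rewrite addrAC [_ + p]addrC; apply: stableZ (cx_stable C _) Ga Gw.
  + by rewrite cx_dB !cx_dZ dw -auv !scalerA mulrC subrr.
  + by apply: addsubB (tors_addsub _ _) _ _ _ _; apply: torsZ.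
exists (x ^+ N *: w, - w').
  split=> /=.
    rewrite mulrnDr addrA [_ + q *+ N]addrC.
    exact: stableZ (cx_stable C _) Gxn Gw.
  by rewrite mulrnDr [n + _ + p]addrAC addrA; apply: stableN (cx_stable C _) Gw'.
split.
  apply/tors_pair; split; first exact: torsZ.
  exact: addsubN (tors_addsub _ _) _ tw'.
congr pair => /=; first by rewrite cx_dZ dw scalerA exprD.
rewrite cx_dN dw' opprK scalerBr !scalerA -exprD [a * _]mulrC.
by rewrite addrC subrK.
Qed.

End ConeNilpotence.

(** * From nilpotence to a domain, by iterated cones *)

Section ConeSelf.
Variables (r : nat) (R : comPzRingType) (gR : zvec r -> set R).
Hypotheses (R_graded : graded_ring gR) (R_noeth : noetherian R).

(* Multiplication by x^N is null-homotopic on its own cone. *)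
Lemma cnilp_cone_self (C : complex gR) x q N (Gx : gR q x)
    (GxN : gR (q *+ N) (x ^+ N)) f :
  cnilp (cone R_graded R_noeth C GxN) [::] f x.
Proof.
exists q => //; exists N => j n [u v] _ [[/= Gu Gv] [du uv] _].
have auv : x ^+ N *: u = cx_d v by apply/eqP; rewrite -subr_eq0 uv.
(* The homotopy sends (u, v) to (v, 0): since x^N u = d v, the cone differential of (v, 0) is x^N
   (u, v). *)
exists (v, 0); first by split=> //=; apply: stable0 (cx_stable C _).
by split=> //; congr pair; rewrite /= ?auv // cx_d0 subr0.
Qed.

Hypotheses (R_pos : positively_graded gR) (R_std : standard gR).
Variables (m : zvec r) (m_ge0 : zle 0 m).

Section Final.
Variables (C : complex gR) (f : nat).

Local Notation Z := (cocycles (@cx_d _ _ _ C) (@cx_comp _ _ _ C)).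
Local Notation B := (boundaries (@cx_d _ _ _ C) (@cx_comp _ _ _ C)).

Definition cohom_ann (p : zvec r) : set R := [set c | gR p c /\
  forall j n z, j < f%:Z -> Z [::] j n z -> B [::] j (n + p) (c *: z)].

Lemma cohom_ann_addsub p : addsub (cohom_ann p).
Proof.
have sB j := boundaries_stable C [::] j.
split=> [|c e [Gc cB] [Ge eB]].
  split=> [|j n z _ _]; first exact: addsub0 (gR_addsub R_graded _).
  by rewrite scale0r; apply: stable0 (sB j).
split=> [|j n z jf Zz]; first exact: addsubB (gR_addsub R_graded _) _ _ Gc Ge.
by rewrite scalerBl; apply: stableB (sB j) (cB _ _ _ jf Zz) (eB _ _ _ jf Zz).
Qed.

Lemma cohom_annM p q c e : gR p c -> cohom_ann q e -> cohom_ann (p + q) (c * e).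
Proof.
move=> Gc [Ge eB]; split=> [|j n z jf Zz]; first exact: gRM.
rewrite -scalerA addrCA; apply: stableZ (boundaries_stable C [::] j) Gc _.
exact: eB.
Qed.

(** Powers of the generators kill the cohomology, so a power of the ideal (R_m) does, and by
    standardness this power contains all R_n with n >= K m. *)
Lemma cohom_ann_power (A : seq R) :
  (forall x, x \in A -> cnilp C [::] f x) ->
  gR m `<=` @span_mod R R^o [set` A] ->
  exists K, forall n, zle (m *+ K) n -> gR n `<=` cohom_ann n.
Proof.
move=> An mA; pose gRg := gR_grading R_graded.
(* The degreewise annihilators are assembled into an ideal of [R], as [ideal_pow_sub] requires. *)
pose T := [set c | forall p, cohom_ann p (gproj gRg c p)].
have TA : addsub T.
  split=> [p|c e Tc Te p].
    by rewrite gproj0; apply: addsub0 (cohom_ann_addsub p).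
  by rewrite gprojB; apply: addsubB (cohom_ann_addsub p) _ _ _ _.
have TM c x : T x -> T (c * x).
  move=> Tx p; rewrite /gRg; have [s ->] := gprojM R_graded c x.
  apply: addsub_sum (cohom_ann_addsub p) _ _ _ _ => k.
  rewrite -[p](subrKC k); apply: cohom_annM; first exact: gproj_in.
  by rewrite subrKC; apply: Tx.
have [x /An[q Gx [N xN]]|K mKT] := ideal_pow_sub TA TM mA.
  exists N => p; rewrite (gproj_homog _ _ (gRX R_graded N Gx)).
  case: eqP => [->|_]; last exact: addsub0 (cohom_ann_addsub p).
  by split; [exact: gRX | exact: xN].
exists K => n mn c Gc; rewrite -(gproj_id gRg Gc); apply: mKT.
exact: (standard_ideal_pow R_graded R_std m_ge0 mn Gc).
Qed.

(** A generator z of degree p reaches degree n only through c z with c in R_(n-p). This is zero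
    unless n >= p, by positivity, and a boundary once n - p >= K m; the remaining n lie in
    [Xdom p (p + m *+ K)]. *)
Lemma vanish_nilp (A : seq R) :
  (forall x, x \in A -> cnilp C [::] f x) ->
  gR m `<=` @span_mod R R^o [set` A] ->
  exists2 X, Qdomain (posupp m) X & vanish C [::] f X.
Proof.
move=> An mA; have [K Kann] := cohom_ann_power An mA.
have sB j := boundaries_stable C [::] j.
(* Negative cohomological degrees are empty, so only the finitely many j with 0 <= j < f need a
   domain. *)
have [|X QX XB] := @Qdomain_bigunion r (posupp m) f
    (fun j => [set n | ~ (Z [::] j%:Z n `<=` B [::] j%:Z n)]); last first.
- exists X => // j n jf nX; case: j jf => [j|j] jf.
    by apply: contrapT => jB; apply: nX; apply: (XB j).
  by move=> z [Gz _ _]; rewrite (cx_neg _ Gz) //; apply: stable0 (sB _).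
move=> j jf; have [L LZ ZL] := cx_fg C j%:Z.
suff [X QX XB] : exists2 X, Qdomain (posupp m) X &
    forall n, ~ X n -> hspan gR (B [::] j%:Z) L n `<=` B [::] j%:Z n.
  exists X => // n nB; apply: contrapT => nX; apply: nB.
  exact: subset_trans (ZL n) (XB n nX).
elim: L LZ {ZL} => [_|[p z] L IHL LZ].
  by exists (Xdom 0 0); [exact: Qdomain_empty | move=> n _ x].
have [|X QX XB] := IHL; first by move=> q y h; apply: LZ; rewrite inE h orbT.
have [|Y QY [XY pY]] := @Qdomain_union r _ X (Xdom p (p + m *+ K)) QX.
  exists p, (p + m *+ K); split=> // i.
    rewrite zvecD zvecMn lerDl; apply: mulrn_wge0.
    by move: (m_ge0 i); rewrite zvec0.
  rewrite /posupp /= addrC addKr zvecMn.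
  by case: (m i =P 0) => // ->; rewrite mul0rn.
exists Y => // n nY x [c Gc xc].
have nX : ~ X n by move=> /XY.
rewrite -[x](subrK (c *: z)); apply: (stableD (sB j)); first exact: XB xc.
have [pn|pn] := pselect (zle p n); last first.
  suff -> : c = 0 by rewrite scale0r; apply: stable0 (sB j).
  suff np : ~ zle 0 (n - p) by move: Gc; rewrite (R_pos np).
  by move=> np; apply: pn => i; move: (np i); rewrite zvecD zvecN zvec0; lia.
rewrite -[n](subrKC p) /=.
suff np : zle (m *+ K) (n - p).
  by have [_ cB] := Kann _ np _ Gc; apply: cB => //; apply: LZ; apply: mem_head.
move=> i; rewrite zvecD zvecN zvecMn.
have npY : ~ Xdom p (p + m *+ K) n by move=> /pY.
rewrite leNgt; apply/negP => ni; apply: npY; exists i.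
by move: (pn i) ni; rewrite zvecD zvecMn; lia.
Qed.

End Final.

(** [A] holds elements known to be nilpotent only on the [xs]-torsion cohomology, [A0] those already
    coned off, nilpotent on the cohomology of the whole complex. Each cone moves one element from
    [A] to [A0] and preserves both kinds of nilpotence; finite generation is exploited once [A] is
    empty. *)
Lemma vanish_tors_nilp (f : nat) (xs A A0 : seq R) (C : complex gR) :
  (forall y, y \in xs -> homogeneous gR y) ->
  (forall x, x \in A -> cnilp C xs f x) ->
  (forall x, x \in A0 -> cnilp C [::] f x) ->
  gR m `<=` @span_mod R R^o [set` A ++ A0] ->
  exists2 X, Qdomain (posupp m) X & vanish C xs f X.
Proof.
move=> xs_hom; elim: A A0 C => [|x A IHA] A0 C An A0n mA.
  have [X QX vX] := vanish_nilp A0n mA; exists X => //.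
  exact: vanish_tors_all QX xs_hom vX.
have [q Gx [N xN]] := An x (mem_head _ _).
have GxN := gRX R_graded N Gx.
have [||| X QX vX] := IHA (x :: A0) (cone R_graded R_noeth C GxN).
- by move=> y yA; apply: cnilp_cone; apply: An; rewrite inE yA orbT.
- move=> y; rewrite inE => /orP[/eqP ->|yA]; first exact: cnilp_cone_self Gx _ _.
  by apply: cnilp_cone; apply: A0n.
- apply: (subset_trans mA); apply: (@span_mono R R^o) => y /=.
  by rewrite !(inE, mem_cat) orbCA.
by exists X => //; apply: vanish_cone vX.
Qed.

End ConeSelf.

(** * Graded injective modules *)

Section Products.
Variables (R : pzRingType) (T : nat -> lmodType R).

(** A [complex] lives on one module, so the terms of a resolution are put into their product. This
    leaves no support condition to maintain; homogeneous parts use only vectors with at most one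
    nonzero entry. *)
Definition prodmod : Type := forall i, T i.

HB.instance Definition _ := Choice.copy prodmod (forall i, T i).

Implicit Types u v w : prodmod.

Definition prodmod_add u v : prodmod := fun i => u i + v i.
Definition prodmod_opp u : prodmod := fun i => - u i.
Definition prodmod_zero : prodmod := fun=> 0.
Definition prodmod_scale (a : R) u : prodmod := fun i => a *: u i.

Lemma prodmodP u v : (forall i, u i = v i) -> u = v.
Proof. by move=> uv; apply: functional_extensionality_dep. Qed.

Fact prodmod_addA : associative prodmod_add.
Proof. by move=> u v w; apply: prodmodP => i; apply: addrA. Qed.

Fact prodmod_addC : commutative prodmod_add.
Proof. by move=> u v; apply: prodmodP => i; apply: addrC. Qed.

Fact prodmod_add0 : left_id prodmod_zero prodmod_add.
Proof. by move=> u; apply: prodmodP => i; apply: add0r. Qed.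

Fact prodmod_addN : left_inverse prodmod_zero prodmod_opp prodmod_add.
Proof. by move=> u; apply: prodmodP => i; apply: addNr. Qed.

HB.instance Definition _ := GRing.isZmodule.Build prodmod
  prodmod_addA prodmod_addC prodmod_add0 prodmod_addN.

Fact prodmod_scaleA a c u :
  prodmod_scale a (prodmod_scale c u) = prodmod_scale (a * c) u.
Proof. by apply: prodmodP => i; apply: scalerA. Qed.

Fact prodmod_scale1 : left_id 1 prodmod_scale.
Proof. by move=> u; apply: prodmodP => i; apply: scale1r. Qed.

Fact prodmod_scaleDr : right_distributive prodmod_scale +%R.
Proof. by move=> a u v; apply: prodmodP => i; apply: scalerDr. Qed.

Fact prodmod_scaleDl u : {morph prodmod_scale^~ u : a c / a + c}.
Proof. by move=> a c; apply: prodmodP => i; apply: scalerDl. Qed.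

HB.instance Definition _ := GRing.Zmodule_isLmodule.Build R prodmod
  prodmod_scaleA prodmod_scale1 prodmod_scaleDr prodmod_scaleDl.

Lemma prodmodB u v i : (u - v) i = u i - v i. Proof. by []. Qed.

Lemma prodmodZ a u i : (a *: u) i = a *: u i. Proof. by []. Qed.

Definition embed i (x : T i) : prodmod := dfwith prodmod_zero x.

Lemma embed_in i (x : T i) : embed x i = x. Proof. exact: dfwith_in. Qed.

Lemma embed_out i (x : T i) j : i != j -> embed x j = 0.
Proof. exact: dfwith_out. Qed.

Lemma embedP i u : (forall j, i != j -> u j = 0) -> u = embed (u i).
Proof.
move=> u0; apply: prodmodP => j; have [<-|ij] := eqVneq i j.
  by rewrite embed_in.
by rewrite embed_out // u0.
Qed.

End Products.

Definition submod_elt (R : pzRingType) (V : lmodType R) (N : submod V) x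
    (Nx : smset N x) : submod_type N :=
  exist (fun x => x \in smpred N) x (mem_set Nx).

Lemma submod_valP (R : pzRingType) (V : lmodType R) (N : submod V)
    (x : submod_type N) : smset N (val x).
Proof. exact: set_mem (valP x). Qed.

Section SubGradings.
Variables (r : nat).

Lemma grading_shift (V : zmodType) (G : zvec r -> set V) (p : zvec r) :
  is_grading G -> is_grading (fun n => G (n - p)).
Proof.
move=> gG; have [G0 _ GU] := gG; split=> [n|x|s c us Gc c0 n ns]; first exact: G0.
  have [s _ xs] := gproj_sum gG x.
  exists [seq n + p | n <- s], (fun n => gproj gG x (n - p)); split.
    by move=> n; apply: gproj_in.
  by rewrite big_map xs; apply: eq_bigr => n _; rewrite -xs addrK.
rewrite -[n](subrK p); apply: (GU [seq n - p | n <- s] (fun n => c (n + p))).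
- by rewrite map_inj_uniq //; apply: addIr.
- by move=> k; rewrite -{1}[k](addrK p); apply: Gc.
- by rewrite big_map -[RHS]c0; apply: eq_bigr => k _; rewrite subrK.
- exact: map_f.
Qed.

Lemma grading_sub (R : pzRingType) (V : lmodType R) (G : zvec r -> set V)
    (gG : is_grading G) (N : submod V) :
  (forall x n, smset N x -> smset N (gproj gG x n)) ->
  is_grading (fun n => [set x : submod_type N | G n (val x)]).
Proof.
move=> Ngr; have valS (s : seq (zvec r)) (c : zvec r -> submod_type N) :
    val (\sum_(n <- s) c n) = \sum_(n <- s) val (c n).
  exact: raddf_sum.
split=> [n|x|s c us Gc c0 n ns].
- apply/zmod_closedP; split=> [|x y Gx Gy] /=.
    exact: addsub0 (grading_addsub gG n).
  exact: addsubB (grading_addsub gG n) _ _ Gx Gy.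
- have Nx n : smset N (gproj gG (val x) n) by apply/Ngr/submod_valP.
  have [s _ xs] := gproj_sum gG (val x).
  exists s, (fun n => submod_elt (Nx n)); split.
    by move=> n; apply: gproj_in.
  by apply: val_inj; rewrite valS; exact: xs.
have [_ _ GU] := gG; apply: val_inj; rewrite raddf0.
by apply: (GU s (fun n => val (c n))) => //; rewrite -valS c0 raddf0.
Qed.

End SubGradings.

(** * Division by powers in graded injective modules *)

Section InjectiveDivision.
Variables (r : nat) (R : comPzRingType) (gR : zvec r -> set R).
Hypotheses (R_graded : graded_ring gR) (R_noeth : noetherian R).

Lemma span_graded (s : seq R) : (forall y, y \in s -> exists p, gR p y) ->
  forall x n, @span_mod R R^o [set` s] x ->
    @span_mod R R^o [set` s] (gproj (gR_grading R_graded) x n).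
Proof.
move=> s_hom x n xs; pose gRg := gR_grading R_graded.
have sA := @span_addsub R R^o [set` s]; move: x xs n.
apply: (@span_min R R^o _
  [set x | forall n, @span_mod R R^o [set` s] (gproj gRg x n)]).
- split=> [n|y z Sy Sz n]; rewrite ?gproj0 ?gprojB; first exact: addsub0.
  exact: addsubB sA _ _ (Sy n) (Sz n).
- move=> c y Sy n; rewrite -[_ *: y]/(c * y) /gRg.
  have [t ->] := gprojM R_graded c y.
  by apply: addsub_sum sA _ _ _ _ => k; apply: (@spanZ R R^o).
move=> y /= ys n; have [p Gy] := s_hom y ys.
rewrite (gproj_homog gRg _ Gy); case: eqP => _; last exact: addsub0.
exact: (@span_sub R R^o).
Qed.

(** The chain of colon ideals (a : x^l) has a finitely generated union, hence becomes stationary at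
    some l. *)
Lemma colon_stable (a : set R) (x : R) (k : nat) :
  addsub a -> (forall c y, a y -> a (c * y)) ->
  exists l, forall c, a (x ^+ (l + k) * c) -> a (x ^+ l * c).
Proof.
move=> aA aM; have up l l' c : (l <= l')%N -> a (x ^+ l * c) -> a (x ^+ l' * c).
  by move=> /subnK <- ac; rewrite exprD -mulrA; apply: aM.
have [s sS Ss] := noetherian_sub [set c | exists l, a (x ^+ l * c)] R_noeth.
have [l sl] : exists l, forall c, c \in s -> a (x ^+ l * c).
  elim: s sS {Ss} => [_|y s IHs sS]; first by exists 0%N.
  have [|l sl] := IHs; first by move=> c cs; apply: sS; apply: mem_behead.
  have [l' yl'] : exists l, a (x ^+ l * y) by apply: sS; apply: mem_head.
  exists (l + l')%N => c; rewrite inE => /orP[/eqP ->|/sl].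
    by apply: up yl'; apply: leq_addl.
  by apply: up; apply: leq_addr.
exists l => c ac.
apply: (@span_min R R^o _ [set c | a (x ^+ l * c)]) (Ss c _).
- split=> [|y z ay az]; rewrite /= ?mulr0 ?mulrBr; first exact: addsub0.
  exact: addsubB.
- by move=> e y ay; rewrite /= -[e *: y]/(e * y) mulrCA; apply: aM.
- exact: sl.
- by exists (l + k)%N.
Qed.

Variable E : grmod gR.

(** The shift R(-n0): as 1 has degree n0, a graded map out of it amounts to an element of degree
    n0. *)
Definition regular_grmod (n0 : zvec r) : grmod gR.
Proof.
apply: (@GrMod r R gR R^o (fun q => gR (q - n0))).
  exact: grading_shift (gR_grading R_graded).
move=> m n a x Ga Gx; rewrite -addrA; exact: gRM.
Defined.

(* For l large, x^(l+k) c + y |-> x^l c w, with y in (s), is well defined on the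
   ideal x^(l+k) R + (s); w' is the image of 1 under an extension to R. *)
Lemma gr_injective_div (E_inj : gr_injective E) n p x (s : seq R) w k :
  gR p x -> (forall y, y \in s -> homogeneous gR y) ->
  gcomp n w -> (forall y, y \in s -> y *: w = 0) ->
  exists l (w' : E), [/\ gcomp (n - p *+ k) w',
    forall y, y \in s -> y *: w' = 0 & x ^+ l *: w = x ^+ (l + k) *: w'].
Proof.
move=> Gx s_hom Gw sw; pose gRg := gR_grading R_graded.
pose a := @span_mod R R^o [set` s].
have aA : addsub a := span_addsub _.
have aM c y : a y -> a (c * y) by apply: spanZ.
have agr y q : a y -> a (gproj gRg y q).
  by apply: span_graded => z /s_hom[u _ Gz]; exists u.
have aw c : a c -> c *: w = 0.
  apply: (@span_min R R^o _ [set c | c *: w = 0]).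
  - by split=> [|y z /= yw zw]; rewrite /= ?scale0r // scalerBl yw zw subrr.
  - by move=> e y /= yw; rewrite /= -[e *: y]/(e * y) -scalerA yw scaler0.
  - exact: sw.
have [l lS] := colon_stable x k aA aM.
(* The degree of w': with 1 in degree n0, x^(l+k) gets the degree of x^l w. *)
pose n0 := n - p *+ k; pose L := (l + k)%N.
pose N : set R^o := [set y | exists c, a (y - x ^+ L * c)].
have NS : submodule N.
  apply/submoduleP; split; first split.
  - by exists 0; rewrite mulr0 subrr; apply: addsub0.
  - move=> y z [c yc] [e ze]; exists (c - e); rewrite mulrBr subrACA.
    exact: addsubB aA _ _ yc ze.
  - move=> e y [c yc]; exists (e * c); rewrite mulrCA -[e *: y]/(e * y) -mulrBr.
    exact: aM.
pose NM := Submod NS.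
have gprojxL y q : gproj gRg (x ^+ L * y) q = x ^+ L * gproj gRg y (q - p *+ L).
  by apply: gprojM_homog; apply: gRX.
have Ngr y q : N y -> N (gproj gRg y q).
  move=> [c yc]; exists (gproj gRg c (q - p *+ L)).
  by rewrite -gprojxL -gprojB; apply: agr.
have Agr : is_grading (fun q => [set y : submod_type NM | gR (q - n0) (val y)]).
  exact: grading_shift n0 (grading_sub (N := NM) Ngr).
have AZ u q c (y : submod_type NM) : gR u c -> gR (q - n0) (val y) ->
    gR (u + q - n0) (val (c *: y)).
  by move=> Gc Gy; rewrite -addrA; apply: gRM.
pose A : grmod gR := @GrMod r R gR (submod_type NM)
  (fun q => [set y : submod_type NM | gR (q - n0) (val y)]) Agr AZ.
have /choice[c cP] (y : submod_type NM) : exists c, a (val y - x ^+ L * c).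
  exact: submod_valP y.
pose phi (y : submod_type NM) : E := (x ^+ l * c y) *: w.
(* Well-definedness, by the choice of l: if x^(l+k) (c - e) lies in (s), so does x^l (c - e), and
   (s) kills w. *)
have phiE y e : a (val y - x ^+ L * e) -> phi y = (x ^+ l * e) *: w.
  move=> ye; have aL : a (x ^+ L * (c y - e)).
    rewrite (_ : _ * _ = val y - x ^+ L * e - (val y - x ^+ L * c y)).
      exact: addsubB aA _ _ ye (cP y).
    by rewrite subrACA subrr sub0r opprB mulrBr.
  by apply/eqP; rewrite -subr_eq0 -scalerBl -mulrBr; apply/eqP; apply: aw (lS _ aL).
have phi_lin : linear phi.
  move=> e y z; rewrite (phiE _ (e * c y + c z)).
    by rewrite mulrDr scalerDl mulrCA -(scalerA e).
  rewrite -[val (e *: y + z)]/(e * val y + val z) mulrDr opprD addrACA mulrCA.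
  rewrite -mulrBr; exact: addsubD aA _ _ (aM _ _ (cP y)) (cP z).
pose phiL : {linear A -> E} :=
  HB.pack phi (GRing.isLinear.Build R A E _ phi phi_lin).
pose valA (y : A) : regular_grmod n0 := val (y : submod_type NM).
have valA_lin : linear valA by [].
pose valL : {linear A -> regular_grmod n0} :=
  HB.pack valA (GRing.isLinear.Build R A (regular_grmod n0) _ valA valA_lin).
have [||| g g_hom gE] := E_inj A (regular_grmod n0) valL phiL.
- by [].
- exact: val_inj.
(* The chosen coefficient need not be homogeneous; its component of the right degree represents y as
   well. *)
- move=> q y Gy; rewrite /= (phiE y (gproj gRg (c y) (q - n0 - p *+ L))).
    have Eq : p *+ l + (q - n0 - p *+ L) + n = q.
      by rewrite /n0 /L; apply: zvecP => i; rewrite !zvecE; lia.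
    rewrite -[in gcomp q]Eq; apply: gscaleP => //; apply: (gRM R_graded).
      exact: gRX.
    exact: gproj_in.
  rewrite -gprojxL -[val y](gproj_id gRg Gy) -gprojB.
  by apply: agr; apply: cP.
have g1 (y : A) : g (val (y : submod_type NM)) = phi y by exact: gE.
have gZ (y : R) : g y = y *: g 1.
  by rewrite -linearZ; congr (g _); apply: esym (mulr1 y).
exists l, (g 1); split.
- by apply: g_hom; rewrite /= subrr; apply: gR1.
- move=> y ys.
  have Ny : N y by exists 0; rewrite mulr0 subr0; apply: span_sub.
  rewrite -gZ (g1 (submod_elt (N := NM) Ny)) (phiE _ 0) ?mulr0 ?scale0r //.
  by rewrite subr0; apply: span_sub.
have Nx : N (x ^+ L) by exists 1; rewrite mulr1 subrr; apply: addsub0.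
rewrite -gZ (g1 (submod_elt (N := NM) Nx)) (phiE _ 1) ?mulr1 //.
by rewrite subrr; apply: addsub0.
Qed.

End InjectiveDivision.

(** * The total complex of a resolution *)

Section EmbedTheory.
Variables (R : comPzRingType) (T : nat -> lmodType R) (i : nat).
Implicit Types (x y : T i).

Lemma embed0 : embed (0 : T i) = 0.
Proof. by symmetry; apply: embedP. Qed.

Lemma embedB x y : embed (x - y) = embed x - embed y.
Proof.
rewrite -[x in LHS]embed_in -[y in LHS]embed_in; symmetry; apply: embedP => j ij.
by rewrite prodmodB !embed_out // subrr.
Qed.

Lemma embedZ a x : embed (a *: x) = a *: embed x.
Proof.
rewrite -[x in LHS]embed_in; symmetry; apply: embedP => j ij.
by rewrite prodmodZ !embed_out // scaler0.
Qed.

Lemma embed_eq0 x : embed x = 0 -> x = 0.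
Proof. by move=> x0; rewrite -[x]embed_in x0. Qed.

Lemma tors_embed xs x : tors xs (embed x) <-> tors xs x.
Proof.
split=> tx y /tx[k xk]; exists k; last by rewrite -embedZ xk embed0.
by apply: embed_eq0; rewrite embedZ.
Qed.

End EmbedTheory.

Section TotalComplex.
Variables (r : nat) (R : comPzRingType) (gR : zvec r -> set R).
Hypotheses (R_graded : graded_ring gR) (R_noeth : noetherian R).
Variables (M : grmod gR) (M_fg : fin_gen [set: M]) (I : inj_resolution M).

Local Notation T := (prodmod (fun i => gmod (I i))).

Definition tot_d (u : T) : T := fun i =>
  match i return (gmod (I i) : Type) with 0%N => 0 | k.+1 => res_d I k (u k) end.

Definition tot_comp (j : int) (n : zvec r) : set T :=
  match j with
  | Posz i => [set u | gcomp n (u i) /\ forall k, i != k -> u k = 0]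
  | Negz _ => [set 0]
  end.

Lemma gcomp_stable (E : grmod gR) : stable gR (@gcomp r R gR E).
Proof.
split=> [n|m n a x]; first exact: grading_addsub (gmodP E) n.
exact: gscaleP.
Qed.

Lemma res_dd i x : res_d I i.+1 (res_d I i x) = 0.
Proof. by apply/res_exact; exists x. Qed.

Lemma tot_comp_embed i n (x : I i) : gcomp n x -> tot_comp i n (embed x).
Proof. by move=> Gx; split; [rewrite embed_in | exact: embed_out]. Qed.

Lemma tot_compE i n u : tot_comp (Posz i) n u -> u = embed (u i).
Proof. by move=> [_]; apply: embedP. Qed.

Lemma tot_d_embed i (x : I i) : tot_d (embed x) = embed (res_d I i x).
Proof.
apply: (etrans (embedP (i := i.+1) _)); last by rewrite /= embed_in.
by move=> [//|k] ik; rewrite /= embed_out // raddf0.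
Qed.

Lemma tot_dB u v : tot_d (u - v) = tot_d u - tot_d v.
Proof. by apply: prodmodP => -[|i]; rewrite prodmodB /= ?subrr // raddfB. Qed.

Lemma tot_dZ a u : tot_d (a *: u) = a *: tot_d u.
Proof. by apply: prodmodP => -[|i]; rewrite prodmodZ /= ?scaler0 // linearZ. Qed.

Lemma tot_dd u : tot_d (tot_d u) = 0.
Proof. by apply: prodmodP => -[|[|i]] //=; rewrite ?raddf0 // res_dd. Qed.

Lemma tot_stable j : stable gR (tot_comp j).
Proof.
case: j => i; last exact: zero_stable.
have sI := gcomp_stable (I i); split=> [n|m n a u Ga [Gu u0]].
  split=> [|u v [Gu u0] [Gv v0]]; first by split=> //; apply: stable0 sI.
  split; first exact: stableB sI Gu Gv.
  by move=> k ik; rewrite prodmodB u0 ?v0 ?subrr.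
split; first exact: stableZ sI Ga Gu.
by move=> k ik; rewrite prodmodZ u0 ?scaler0.
Qed.

Lemma PoszS i : (i.+1%:Z - 1 = i)%R. Proof. by lia. Qed.

Lemma tot_d_comp j n u : tot_comp j n u -> tot_comp (j + 1) n (tot_d u).
Proof.
case: j => i Gu; last first.
  rewrite {}Gu (_ : tot_d 0 = 0); first exact: stable0 (tot_stable _).
  by rewrite -[0 in LHS](scale0r 0) tot_dZ scale0r.
rewrite (_ : i%:Z + 1 = i.+1); last by lia.
rewrite (tot_compE Gu) tot_d_embed; apply: tot_comp_embed.
by apply: res_d_hom; case: Gu.
Qed.

Lemma tot_neg j n u : j < 0 -> tot_comp j n u -> u = 0.
Proof. by case: j => i. Qed.

Lemma tot_div j n p x (s : seq R) w k :
  gR p x -> (forall y, y \in s -> homogeneous gR y) ->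
  tot_comp j n w -> (forall y, y \in s -> y *: w = 0) ->
  exists l w', [/\ tot_comp j (n - p *+ k) w',
    forall y, y \in s -> y *: w' = 0 & x ^+ l *: w = x ^+ (l + k) *: w'].
Proof.
move=> Gx s_hom; case: j => i Gw sw; last first.
  by exists 0%N, 0; rewrite Gw !scaler0; split=> // y _; rewrite scaler0.
rewrite (tot_compE Gw) in sw *; case: Gw => Gw _.
have [|l [w' [Gw' sw' xw]]] :=
    gr_injective_div R_graded R_noeth (@res_obj_inj _ _ _ _ I i) k Gx s_hom Gw.
  by move=> y ys; apply: (@embed_eq0 _ (fun i => gmod (I i))); rewrite embedZ sw.
exists l, (embed w'); split; first exact: tot_comp_embed.
  by move=> y ys; rewrite -embedZ sw' // embed0.
by rewrite -!embedZ xw.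
Qed.

Lemma grmod_fg : exists2 L : seq (zvec r * M),
  forall p z, (p, z) \in L -> gcomp p z &
  forall n, gcomp n `<=` hspan gR (@zero_family r R M) L n.
Proof.
have M_span : fin_gen (span_mod [set z : M | exists p, gcomp p z]).
  rewrite (_ : span_mod _ = setT) //; apply/seteqP; split=> // x _.
  have [s _ ->] := gproj_sum (gmodP M) x.
  apply: addsub_sum (span_addsub _) _ _ _ _ => n.
  by apply: span_sub; exists n; apply: gproj_in.
have [s sS Ss] := fin_gen_sub M_span.
have [|L Ls LG] := @tag_degrees (zvec r) M (@gcomp r R gR M) s.
  by move=> x xs; apply: sS.
exists L => // n x Gx; rewrite -(gproj_id (gmodP M) Gx).
apply: (span_hspan R_graded) => //; first exact: gscaleP.
by rewrite Ls; apply: Ss; exists n.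
Qed.

(** By exactness the cohomology is zero in positive degrees and the image of [M] in degree 0,
    generated by the images of generators of [M]. *)
Lemma tot_fg j : exists2 L,
  forall p z, (p, z) \in L -> cocycles tot_d tot_comp [::] j p z &
  forall n, cocycles tot_d tot_comp [::] j n `<=`
    hspan gR (boundaries tot_d tot_comp [::] j) L n.
Proof.
have sB i : stable gR (boundaries tot_d tot_comp [::] i).
  split=> [n|m n c x Gc [y Gy [_ <-]]].
    split=> [|_ _ [y Gy [_ <-]] [u Gu [_ <-]]].
      exists 0; first exact: stable0 (tot_stable _).
      by split=> //; rewrite -[0 in LHS](scale0r 0) tot_dZ scale0r.
    exists (y - u); first exact: stableB (tot_stable _) Gy Gu.
    by rewrite tot_dB.
  exists (c *: y); first exact: stableZ (tot_stable _) Gc Gy.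
  by rewrite tot_dZ.
case: j => [[|i]|i]; last first.
- by exists [::] => // n u [-> _ _]; apply: stable0 (sB _).
- exists [::] => // n u [Gu du _]; have uE := tot_compE Gu.
  rewrite uE tot_d_embed in du; have /res_exact[y uy] := embed_eq0 du.
  (* Exactness gives a preimage that need not be homogeneous; its component of degree n is a
     preimage too. *)
  exists (embed (gproj (gmodP (I i)) y n)).
    rewrite PoszS; exact: tot_comp_embed (gproj_in _ _ _).
  split=> //; rewrite tot_d_embed [in RHS]uE; congr embed.
  have [Gui _] := Gu; rewrite -(gproj_id (gmodP (I i.+1)) Gui) uy.
  rewrite -[n in RHS]addr0; symmetry; apply: gproj_morph; first exact: raddfD.
  by move=> k v Gv; rewrite addr0; apply: res_d_hom.
have [L LG GL] := grmod_fg.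
exists [seq (q.1, embed (res_aug I q.2)) | q <- L].
  move=> p z /mapP[[q y] /LG Gy [-> ->]]; split=> //.
    exact: tot_comp_embed (res_aug_hom _ Gy).
  rewrite tot_d_embed (_ : res_d I 0 _ = 0) ?embed0 //.
  by apply/res_exact0; exists y.
move=> n u [Gu du _]; have uE := tot_compE Gu.
rewrite uE tot_d_embed in du; have /res_exact0[y uy] := embed_eq0 du.
(* The injective augmentation sends [y] and its component of degree n to the same element. *)
have yE : gproj (gmodP M) y n = y.
  apply: (@res_aug_inj _ _ _ _ I); rewrite -uy.
  have [Gui _] := Gu; rewrite -[RHS](gproj_id (gmodP (I 0%N)) Gui) uy.
  rewrite -[n in RHS]addr0; symmetry; apply: gproj_morph; first exact: raddfD.
  by move=> k v Gv; rewrite addr0; apply: res_aug_hom.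
set L' := [seq _ | _ <- L]; rewrite uE uy.
have sH := hspan_stable R_graded L' (sB 0%N).
pose W k : set M :=
  [set y | hspan gR (boundaries tot_d tot_comp [::] 0%N) L' k (embed (res_aug I y))].
have sW : stable gR W.
  split=> [k|k l c v Gc Hv].
    split=> [|y1 y2 H1 H2]; rewrite /W /= ?raddf0 ?embed0 ?raddfB ?embedB.
      exact: stable0 sH.
    exact: stableB sH H1 H2.
  by rewrite /W /= linearZ embedZ; apply: stableZ sH Gc Hv.
have LW p z : (p, z) \in L -> W p z.
  by move=> zL; apply: hspan_mem => //; apply/mapP; exists (p, z).
have zW k : zero_family k `<=` W k by move=> _ ->; apply: stable0 sW.
apply: (hspan_min sW zW LW); apply: GL.
by rewrite -yE; apply: gproj_in.
Qed.

Definition total_complex : complex gR :=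
  @Complex _ _ _ T tot_d tot_comp tot_dB tot_dZ tot_dd tot_stable
    tot_d_comp tot_neg tot_div tot_fg.

End TotalComplex.

(** * Local cohomology *)

Lemma lquot_pi_eq0 (R : pzRingType) (V : lmodType R) (B : submod V) (x : V) :
  \pi_(Quotient.quot (smpred B))%qT x = 0 :> lquot B <-> smset B x.
Proof.
have E : (\pi_(Quotient.quot (smpred B))%qT x == 0 :> lquot B) = (x \in smpred B).
  rewrite -[x in RHS]subr0 Quotient.idealrBE.
  by rewrite -[0 in LHS](raddf0 \pi_(Quotient.quot (smpred B))%qT).
by split=> [/eqP|Bx]; [rewrite E inE | apply/eqP; rewrite E inE].
Qed.

Section LocalCohomology.
Variables (r : nat) (R : comPzRingType) (gR : zvec r -> set R).
Hypotheses (R_graded : graded_ring gR) (R_noeth : noetherian R).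
Hypotheses (R_pos : positively_graded gR) (R_std : standard gR).
Variables (M : grmod gR) (M_fg : fin_gen [set: M]).
Variables (b : set R) (b_ideal : ideal b) (b_graded : graded_subset gR b).
Variable I : inj_resolution M.

(** Positivity puts the generators in nonnegative degrees, as [Qdomain_beyond] requires: components
    in other degrees are 0, which is also homogeneous of degree 0. *)
Lemma homogeneous_generators : exists2 xs : seq R,
  forall y, y \in xs -> homogeneous gR y /\ b y &
  b `<=` @span_mod R R^o [set` xs].
Proof.
have [xs xsS Sxs] :=
  noetherian_sub [set x | homogeneous gR x /\ b x] R_noeth.
exists xs => [y /xsS //|x /b_graded[s [c [cP ->]]]].
apply: addsub_sum (@span_addsub R R^o _) _ _ _ _ => n.
have [Gc bc] := cP n; apply: Sxs; split=> //.
have [n0|n0] := pselect (zle 0 n); first by exists n.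
exists 0; first by [].
have -> : c n = 0 by move: Gc; rewrite (R_pos n0).
exact: addsub0 (gR_addsub R_graded _).
Qed.

Variable xs : seq R.
Hypotheses (xs_hom : forall y, y \in xs -> homogeneous gR y /\ b y)
  (b_xs : b `<=` @span_mod R R^o [set` xs]).

(** The power b^k contains y^k for each generator y; conversely, the annihilator of v contains
    powers of all generators, hence a power of b. *)
Lemma torsion_tors (V : lmodType R) (v : V) : torsion b v <-> tors xs v.
Proof.
split=> [[k bk] y ys|tv].
  exists k; apply: bk; apply: (@span_sub R R^o).
  exists (fun=> y); first by move=> _; case: (xs_hom ys).
  by rewrite prodr_const card_ord.
have [||K bK] := @ideal_pow_sub R xs b [set c | c *: v = 0] _ _ b_xs tv.
- by split=> [|y z /= yv zv]; rewrite /= ?scale0r // scalerBl yv zv subrr.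
- by move=> c x /= xv; rewrite /= -scalerA xv scaler0.
by exists K => c /bK.
Qed.

Local Notation C := (total_complex R_graded R_noeth M_fg I).
Local Notation Z := (cocycles (@cx_d _ _ _ C) (@cx_comp _ _ _ C)).
Local Notation B := (boundaries (@cx_d _ _ _ C) (@cx_comp _ _ _ C)).

Local Notation bset i := (@boundary_set R b r gR M I i).

Definition loc_pi i (z : submod_type (cocycle b I i)) : loc_coh b I i :=
  subquot_pi (boundary b I i) z.

Lemma loc_pi_ind i (P : loc_coh b I i -> Prop) :
  (forall z, P (loc_pi z)) -> forall c, P c.
Proof. exact: lquot_ind. Qed.

Lemma loc_pi_eq0 i (z : submod_type (cocycle b I i)) :
  loc_pi z = 0 <-> bset i (val z).
Proof. exact: lquot_pi_eq0. Qed.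

Lemma loc_piZ i a (z : submod_type (cocycle b I i)) :
  a *: loc_pi z = loc_pi (a *: z).
Proof. exact: lquot_scale_pi. Qed.

Lemma cocycleP i (z : I i) :
  smset (cocycle b I i) z <-> tors xs z /\ res_d I i z = 0.
Proof. by split=> -[/torsion_tors]. Qed.

Lemma tot_cocycle i n (z : I i) : gcomp n z -> smset (cocycle b I i) z ->
  Z xs i n (embed z).
Proof.
move=> Gz /cocycleP[tz dz]; split; first exact: tot_comp_embed.
  by rewrite /= tot_d_embed dz embed0.
exact/tors_embed.
Qed.

Lemma tot_boundary i n (z : I i) : gcomp n z -> bset i z ->
  B xs i n (embed z).
Proof.
case: i z => [z _ ->|i z Gz [y /torsion_tors ty dy]].
  exists 0; first by [].
  split; first exact: addsub0 (tors_addsub _ _).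
  by rewrite cx_d0 embed0.
(* [y] need not be homogeneous; its component stays torsion because the elements of [xs] are
   homogeneous. *)
pose y' := gproj (gmodP (I i)) y n.
exists (embed y'); first by rewrite PoszS; exact: tot_comp_embed (gproj_in _ _ _).
split.
  apply/tors_embed => x xs_x; have [k xy] := ty x xs_x; exists k.
  have [[p _ Gx] _] := xs_hom xs_x.
  rewrite /y' -(gproj_morph (gmodP (I i)) (gmodP (I i))
    (h := fun y => x ^+ k *: y) (p := p *+ k)).
  - by rewrite xy gproj0.
  - by move=> u v; rewrite scalerDr.
  - by move=> l u Gu; rewrite addrC; apply: gscaleP => //; apply: gRX.
rewrite /= tot_d_embed; congr embed.
rewrite -(gproj_id (gmodP (I i.+1)) Gz) -dy -[n in RHS]addr0; symmetry.
apply: gproj_morph; first exact: raddfD.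
by move=> k v Gv; rewrite addr0; apply: res_d_hom.
Qed.

Lemma boundary_tot i n (z : I i) : B xs i n (embed z) -> bset i z.
Proof.
case: i z => [z [y y0 [_ dy]]|i z [y]].
  have {}y0 : y = 0 := y0.
  by rewrite y0 cx_d0 in dy; apply: embed_eq0 (esym dy).
rewrite PoszS => Gy; rewrite (tot_compE Gy) /= tot_d_embed => -[ty dy].
exists (y i); first by apply/torsion_tors/tors_embed.
by have := congr1 (fun u => u i.+1) dy; rewrite !embed_in.
Qed.

Lemma cocycle_gproj i n (z : I i) : smset (cocycle b I i) z ->
  smset (cocycle b I i) (gproj (gmodP (I i)) z n).
Proof.
move=> /cocycleP[tz dz]; apply/cocycleP; split.
  move=> x xs_x; have [k xz] := tz x xs_x; exists k.
  have [[p _ Gx] _] := xs_hom xs_x.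
  rewrite -(gproj_morph (gmodP (I i)) (gmodP (I i))
    (h := fun y => x ^+ k *: y) (p := p *+ k)).
  - by rewrite xz gproj0.
  - by move=> u v; rewrite scalerDr.
  - by move=> l u Gu; rewrite addrC; apply: gscaleP => //; apply: gRX.
rewrite -(gproj_morph (gmodP (I i)) (gmodP (I i.+1)) (h := res_d I i) (p := 0)).
- by rewrite dz gproj0.
- exact: raddfD.
- by move=> k v Gv; rewrite addr0; apply: res_d_hom.
Qed.

Lemma supp_vanish f X : vanish C xs f%:Z X ->
  forall i, (i < f)%N -> supp (loc_coh_comp b I i) `<=` X.
Proof.
move=> vX i i_f n [c [[z /= Gz <-] z0]]; apply: contrapT => nX; apply: z0.
apply/loc_pi_eq0/(@boundary_tot i n); apply: vX => //.
exact: tot_cocycle Gz (submod_valP z).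
Qed.

Lemma boundary_of_supp i n (z : I i) : gcomp n z -> smset (cocycle b I i) z ->
  ~ supp (loc_coh_comp b I i) n -> bset i z.
Proof.
move=> Gz Zz nS; apply: contrapT => nB; apply: nS.
exists (loc_pi (submod_elt Zz)); split; first by exists (submod_elt Zz).
by move=> /loc_pi_eq0.
Qed.

Lemma cnilp_radical f p x : gR p x ->
  (forall i, (i < f)%N -> radical (annihilator (loc_coh b I i)) x) ->
  cnilp C xs f%:Z x.
Proof.
move=> Gx xf; exists p => //.
(* The radicals give one exponent per i; finitely many i admit a common one. *)
have [N xN] : exists N, forall i, (i < f)%N -> annihilator (loc_coh b I i) (x ^+ N).
  elim: f xf => [_|f IHf xf]; first by exists 0%N.
  have [|N xN] := IHf; first by move=> i /ltnW; apply: xf.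
  have [k xk] := xf f (ltnSn f); exists (N + k)%N => i.
  rewrite ltnS leq_eqVlt => /orP[/eqP -> c|/xN i_f c].
    by rewrite exprD -scalerA xk scaler0.
  by rewrite exprD mulrC -scalerA i_f scaler0.
exists N => -[i|i] n z i_f [Gz dz tz]; last first.
  by rewrite Gz scaler0; apply: stable0 (boundaries_stable C _ _).
have zE := tot_compE Gz; have [Gzi _] := Gz.
rewrite zE /= tot_d_embed in dz; have dzi := embed_eq0 dz.
rewrite zE in tz; have tzi := (tors_embed _ _).1 tz.
have Zz : smset (cocycle b I i) (z i) by apply/cocycleP.
rewrite zE -embedZ; apply: tot_boundary.
  by rewrite addrC; apply: gscaleP => //; apply: gRX.
have := xN i i_f (loc_pi (submod_elt Zz)); rewrite loc_piZ => /loc_pi_eq0.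
by [].
Qed.

(** [Qdomain_escape] bounds the number of steps uniformly in the starting degree, so a single power
    of [a] kills all homogeneous components of every class. *)
Lemma radical_of_supp (m : zvec r) X i : zle 0 m -> Qdomain (posupp m) X ->
  supp (loc_coh_comp b I i) `<=` X ->
  gR m `<=` radical (annihilator (loc_coh b I i)).
Proof.
move=> m0 QX SX a Ga; have [K escK] := Qdomain_escape m0 QX; exists K.
elim/loc_pi_ind => z; rewrite loc_piZ; apply/loc_pi_eq0.
rewrite -[val _]/(a ^+ K *: val z); have Zz := submod_valP z.
have [s _ ->] := gproj_sum (gmodP (I i)) (val z); rewrite scaler_sumr.
have [bA bZ] := (submoduleP _).1 (smsetP (boundary b I i)).
apply: addsub_sum bA _ _ _ _ => n.
have [k kK nX] := escK n.
rewrite -(subnK kK) exprD -scalerA; apply: bZ.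
have Zzn := cocycle_gproj n Zz.
apply: (@boundary_of_supp i (n + m *+ k)); last by move=> /SX.
  rewrite addrC; apply: gscaleP; first exact: gRX.
  exact: gproj_in.
exact: ((submoduleP _).1 (smsetP (cocycle b I i))).2.
Qed.

Lemma vanish_radical (m : zvec r) f : zle 0 m ->
  (forall i, (i < f)%N -> gR m `<=` radical (annihilator (loc_coh b I i))) ->
  exists2 X, Qdomain (posupp m) X & vanish C xs f%:Z X.
Proof.
move=> m0 mrad; have [A AR mA] := noetherian_sub (gR m) R_noeth.
apply: (@vanish_tors_nilp _ _ _ R_graded R_noeth R_pos R_std m m0 f xs A [::]).
- by move=> y /xs_hom[].
- by move=> x /AR Gx; apply: (cnilp_radical Gx) => i /mrad; apply.
- by [].
- by rewrite cats0.
Qed.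

End LocalCohomology.

(** [findim_set] is closed downwards and contains 0, so it attains its supremum when bounded; [None]
    occurs only when it is unbounded. *)
Lemma le_findim (R : comPzRingType) (b : set R) r (gR : zvec r -> set R)
    (M : grmod gR) (I : inj_resolution M) (Q : set 'I_r) f :
  le_natinfty f (findim b I Q) <-> findim_set b I Q f.
Proof.
set S := findim_set b I Q.
have down k l : (k <= l)%N -> S l -> S k.
  by move=> kl Sl i ik; apply: Sl; apply: leq_trans kl.
rewrite /le_natinfty /findim; split; last first.
  case: asboolP => // -[k kS] Sf; rewrite -leEnat.
  by apply: ge_supremum_Nmem => //; exists k.
case: asboolP => [[k kS] f_sup|nsup _]; last first.
  apply: contrapT => nSf; apply: nsup; apply: nat_supremums_neq0; exists f.
  by move=> k Sk; apply: contrapT => /negP; rewrite -ltNge => /ltnW/down/(_ Sk).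
case: f f_sup => [//|f] f_sup; apply: contrapT => nSf.
have [_ sup_le] : supremums S (supremum 0%N S).
  (* The default value of [supremum] concerns the empty set only, and 0 belongs to [S]. *)
  rewrite /supremum ifF; last first.
    by apply/eqP => S_eq0; have : S 0%N by []; rewrite S_eq0.
  by case: xgetP => [l -> //|/(_ k)].
suff /sup_le : ubound S f by move=> /(leq_trans f_sup); rewrite ltnn.
by move=> l Sl; apply: contrapT => /negP; rewrite -ltNge => /down/(_ Sl).
Qed.

Theorem proposition5p18 (r : nat) (r_gt0 : (0 < r)%N)
    (R : comPzRingType) (gR : zvec r -> set R)
    (R_graded : graded_ring gR) (R_noeth : noetherian R)
    (R_pos : positively_graded gR) (R_std : standard gR)
    (M : grmod gR) (M_fg : fin_gen [set: M])
    (b : set R) (b_ideal : ideal b) (b_graded : graded_subset gR b)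
    (m : zvec r) (m_ge0 : zle 0 m) (m_neq0 : m <> 0)
    (f : nat) (f_gt0 : (0 < f)%N)
    (I : inj_resolution M) :
  [<-> (forall i, (i < f)%N -> gR m `<=` radical (annihilator (loc_coh b I i)));
       (forall i, (i < f)%N -> exists2 X, Qdomain (posupp m) X &
          supp (loc_coh_comp b I i) `<=` X);
       le_natinfty f (findim b I (posupp m));
       exists2 X, Qdomain (posupp m) X &
          forall i, (i < f)%N -> supp (loc_coh_comp b I i) `<=` X].
Proof.
have [xs xs_hom b_xs] := homogeneous_generators R_graded R_noeth R_pos b_graded.
tfae.
- move=> mrad.
  have [X QX vX] := vanish_radical R_graded R_noeth R_pos R_std M_fg
    xs_hom b_xs m_ge0 mrad.
  by move=> i i_f; exists X => //; apply: (supp_vanish xs_hom b_xs vX i_f).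
- by move=> SX; apply/le_findim.
- by move=> /le_findim; apply: Qdomain_bigunion.
- move=> [X QX SX] i i_f.
  exact: (radical_of_supp R_graded xs_hom b_xs m_ge0 QX (SX i i_f)).
Qed.
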